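(* Let $n\ge 1$ and let $\dot z\in\mathbb{C}$ be nonzero, with a fixed square root $\sqrt{\dot z}$. Then there is an isomorphism of associative algebras $$\phi_{\dot z}:\ U(\mathfrak{g}_n)/\langle z-\dot z\rangle\ \longrightarrow\ U(\mathfrak{sp}_{2n})\otimes \mathfrak{D}_n$$ given on generators, for $1\le i,j\le n$, by $$X_{\epsilon_i-\epsilon_j}\mapsto X_{\epsilon_i-\epsilon_j}\otimes 1+1\otimes t_i\partial_j\ (i\neq j),$$ $$X_{\epsilon_i+\epsilon_j}\mapsto X_{\epsilon_i+\epsilon_j}\otimes 1+1\otimes t_it_j,$$ $$X_{-\epsilon_i-\epsilon_j}\mapsto X_{-\epsilon_i-\epsilon_j}\otimes 1-1\otimes \partial_i\partial_j,$$ $$h_i\mapsto h_i\otimes 1+1\otimes t_i\partial_i+\tfrac12,$$ $$X_{\epsilon_i}\mapsto 1\otimes\sqrt{\dot z}\,t_i,\qquad X_{-\epsilon_i}\mapsto -1\otimes\sqrt{\dot z}\,\partial_i.$$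
   Context: $\mathfrak{sp}_{2n}$ is the Lie algebra of complex $2n\times 2n$ matrices $\begin{pmatrix}A&B\\ C&-A^T\end{pmatrix}$ with $B=B^T$, $C=C^T$. Let $e_1,\dots,e_{2n}$ be the standard basis of $\mathbb{C}^{2n}$. The Heisenberg Lie algebra is $H_n=\mathbb{C}^{2n}\oplus\mathbb{C}z$ with $[e_i,e_{n+i}]=z$ for $1\le i\le n$, $[z,H_n]=0$, and all other brackets of basis vectors zero (up to antisymmetry). The symplectic oscillator Lie algebra is $\mathfrak{g}_n=\mathfrak{sp}_{2n}\ltimes H_n$ with $[X,v]=Xv$ (matrix multiplication) and $[X,z]=0$ for $X\in\mathfrak{sp}_{2n}$, $v\in\mathbb{C}^{2n}$. With $e_{ij}$ the matrix units, for $1\le i,j\le n$ put $h_i=e_{i,i}-e_{n+i,n+i}$, $X_{\epsilon_i}=e_i$, $X_{-\epsilon_i}=e_{n+i}$, $X_{\epsilon_i+\epsilon_j}=e_{i,n+j}+e_{j,n+i}$, $X_{-\epsilon_i-\epsilon_j}=e_{n+i,j}+e_{n+j,i}$ ($i=j$ allowed), and $X_{\epsilon_i-\epsilon_j}=e_{i,j}-e_{n+j,n+i}$ for $i\ne j$. These elements together with $z$ span $\mathfrak{g}_n$. $U(\cdot)$ denotes the universal enveloping algebra and $\langle z-\dot z\rangle$ is the two-sided ideal generated by $z-\dot z$. $\mathfrak{D}_n$ is the Weyl algebra of rank $n$: the associative $\mathbb{C}$-algebra generated by $t_1,\dots,t_n,\partial_1,\dots,\partial_n$ with relations $[\partial_i,\partial_j]=[t_i,t_j]=0$,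 $[\partial_i,t_j]=\delta_{i,j}$. The tensor product is the usual tensor product of associative algebras over $\mathbb{C}$. *)

(* Defs.v *)
From HB Require Import structures.
From mathcomp Require Import all_boot all_algebra finmap.
From mathcomp Require Import boolp ring.
From mathcomp Require Import monalg.

Set Implicit Arguments.
Unset Strict Implicit.
Unset Printing Implicit Defensive.

Import GRing.Theory.
Local Open Scope ring_scope.
Local Open Scope quotient_scope.

(* MathComp's [algType] requires [1 != 0], which a quotient by a two-sided ideal
   need not satisfy; an algebra over [K] is here a possibly trivial ring with a
   central ring morphism [scal] from [K], so that scaling by [a] is
   multiplication by [scal a]. *)
HB.mixin Record isPzAlgebra (K : pzRingType) A of GRing.PzRing A := {
  scal : K -> A;
  scal_is_zmod_morphism : zmod_morphism scal;
  scal_is_monoid_morphism : monoid_morphism scal;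
  scalC : forall (a : K) (x : A), scal a * x = x * scal a
}.

#[short(type="palgType")]
HB.structure Definition PzAlgebra (K : pzRingType) :=
  {A of GRing.PzRing A & isPzAlgebra K A}.

HB.instance Definition _ (K : pzRingType) (A : palgType K) :=
  GRing.isZmodMorphism.Build K A scal (@scal_is_zmod_morphism K A).
HB.instance Definition _ (K : pzRingType) (A : palgType K) :=
  GRing.isMonoidMorphism.Build K A scal (@scal_is_monoid_morphism K A).

HB.mixin Record isLieAlgebra (K : pzRingType) L of GRing.Lmodule K L := {
  lie : L -> L -> L;
  lie_linearl : forall (a : K) (x y z : L),
    lie (a *: x + y) z = a *: lie x z + lie y z;
  lie_linearr : forall (a : K) (x y z : L),
    lie x (a *: y + z) = a *: lie x y + lie x z;
  lie_alt : forall x : L, lie x x = 0;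
  lie_jacobi : forall x y z : L,
    lie x (lie y z) + lie y (lie z x) + lie z (lie x y) = 0
}.

#[short(type="lieAlgType")]
HB.structure Definition LieAlgebra (K : pzRingType) :=
  {L of GRing.Lmodule K L & isLieAlgebra K L}.

Section IdealQuotient.
Variables (K : pzRingType) (A : palgType K) (S : A -> Prop).

Definition two_sided_ideal (I : A -> Prop) : Prop :=
  [/\ I 0, forall x y, I x -> I y -> I (x - y),
      forall a x, I x -> I (a * x) & forall a x, I x -> I (x * a)].

Definition ideal_gen : {pred A} := fun x =>
  `[< forall I, two_sided_ideal I -> (forall y, S y -> I y) -> I x >].

Fact ideal_gen_zmod_closed : zmod_closed ideal_gen.
Proof.
split=> [|x y /asboolP Sx /asboolP Sy]; apply/asboolP => I I_ideal SI.
  by case: I_ideal.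
by case: (I_ideal) => _ IB _ _; apply: IB; [apply: Sx | apply: Sy].
Qed.
HB.instance Definition _ :=
  GRing.isZmodClosed.Build A ideal_gen ideal_gen_zmod_closed.

Fact ideal_genMl a x : x \in ideal_gen -> a * x \in ideal_gen.
Proof.
move=> /asboolP Sx; apply/asboolP => I I_ideal SI.
by case: (I_ideal) => _ _ IM _; apply: IM; apply: Sx.
Qed.

Fact ideal_genMr a x : x \in ideal_gen -> x * a \in ideal_gen.
Proof.
move=> /asboolP Sx; apply/asboolP => I I_ideal SI.
by case: (I_ideal) => _ _ _ IM; apply: IM; apply: Sx.
Qed.

Definition quot_alg := Quotient.quot ideal_gen.
HB.instance Definition _ := GRing.Zmodule.on quot_alg.

Definition quot_pi (x : A) : quot_alg := \pi_quot_alg x.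

Fact quot_piP x y : reflect (quot_pi x = quot_pi y) (x - y \in ideal_gen).
Proof. by rewrite Quotient.idealrBE; apply: eqP. Qed.

Fact quot_piK (q : quot_alg) : quot_pi (repr q) = q.
Proof. exact: reprK. Qed.

Fact quot_piD x y : quot_pi (x + y) = quot_pi x + quot_pi y.
Proof. by rewrite /quot_pi !piE. Qed.

Definition quot_one : quot_alg := quot_pi 1.
Definition quot_mul (p q : quot_alg) : quot_alg := quot_pi (repr p * repr q).

Fact quot_pi_repr x : repr (quot_pi x) - x \in ideal_gen.
Proof. by apply/quot_piP; rewrite quot_piK. Qed.

Fact quot_piM x y : quot_mul (quot_pi x) (quot_pi y) = quot_pi (x * y).
Proof.
apply/quot_piP; set x' := repr _; set y' := repr _.
have -> : x' * y' - x * y = (x' - x) * y' + x * (y' - y).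
  by rewrite mulrBl mulrBr addrA subrK.
by apply: rpredD; [apply: ideal_genMr | apply: ideal_genMl]; apply: quot_pi_repr.
Qed.

Fact quot_mulA : associative quot_mul.
Proof.
by move=> p q r; rewrite -[p]quot_piK -[q]quot_piK -[r]quot_piK !quot_piM mulrA.
Qed.
Fact quot_mul1 : left_id quot_one quot_mul.
Proof. by move=> p; rewrite -[p]quot_piK quot_piM mul1r. Qed.
Fact quot_1mul : right_id quot_one quot_mul.
Proof. by move=> p; rewrite -[p]quot_piK quot_piM mulr1. Qed.
Fact quot_mulDl : left_distributive quot_mul +%R.
Proof.
move=> p q r; rewrite -[p]quot_piK -[q]quot_piK -[r]quot_piK.
by rewrite -quot_piD !quot_piM -quot_piD mulrDl.
Qed.
Fact quot_mulDr : right_distributive quot_mul +%R.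
Proof.
move=> p q r; rewrite -[p]quot_piK -[q]quot_piK -[r]quot_piK.
by rewrite -quot_piD !quot_piM -quot_piD mulrDr.
Qed.
HB.instance Definition _ := GRing.Zmodule_isPzRing.Build quot_alg
  quot_mulA quot_mul1 quot_1mul quot_mulDl quot_mulDr.

Fact quot_pi_is_zmod_morphism : zmod_morphism quot_pi.
Proof. by move=> x y; rewrite /quot_pi !piE. Qed.
HB.instance Definition _ :=
  GRing.isZmodMorphism.Build A quot_alg quot_pi quot_pi_is_zmod_morphism.
Fact quot_pi_is_monoid_morphism : monoid_morphism quot_pi.
Proof. by split=> // x y; rewrite [RHS]quot_piM. Qed.
HB.instance Definition _ :=
  GRing.isMonoidMorphism.Build A quot_alg quot_pi quot_pi_is_monoid_morphism.

Definition quot_scal (a : K) : quot_alg := quot_pi (scal a).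
Fact quot_scal_is_zmod_morphism : zmod_morphism quot_scal.
Proof. by move=> a b; rewrite /quot_scal !rmorphB. Qed.
Fact quot_scal_is_monoid_morphism : monoid_morphism quot_scal.
Proof. by split=> [|a b]; rewrite /quot_scal ?rmorph1 // !rmorphM. Qed.
Fact quot_scalC (a : K) (x : quot_alg) : quot_scal a * x = x * quot_scal a.
Proof. by rewrite -[x]quot_piK /quot_scal -!rmorphM scalC. Qed.
HB.instance Definition _ := isPzAlgebra.Build K quot_alg
  quot_scal_is_zmod_morphism quot_scal_is_monoid_morphism quot_scalC.

End IdealQuotient.

(* [monalg] makes [{malg K[M]}] a ring only when [M] has no nontrivial units
   ([monomType]), which excludes the multiplicative monoid [A * B] underlying the
   tensor product below; hence this product for an arbitrary monoid. *)
Section MonoidAlgebra.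
Variables (K : comNzRingType) (M : monoidType).

Definition monoid_alg := {malg K[M]}.
HB.instance Definition _ := GRing.Lmodule.on monoid_alg.

Definition mbase (m : M) : monoid_alg := << 1 *g m >>.

Definition mlin (V : lmodType K) (f : M -> V) (x : monoid_alg) : V :=
  \sum_(m <- msupp x) x@_m *: f m.

Fact mlinEw (V : lmodType K) (f : M -> V) (x : monoid_alg) (d : {fset M}) :
  (msupp x `<=` d)%fset -> mlin f x = \sum_(m <- d) x@_m *: f m.
Proof.
move=> sd; rewrite /mlin (big_fset_incl _ sd) //.
by move=> m _ /mcoeff_outdom ->; rewrite scale0r.
Qed.

Fact mlin_is_linear (V : lmodType K) (f : M -> V) : linear (mlin f).
Proof.
move=> c x y; pose d := (msupp x `|` msupp y)%fset.
have sx : (msupp x `<=` d)%fset by apply: fsubsetUl.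
have sy : (msupp y `<=` d)%fset by apply: fsubsetUr.
have scxy : (msupp (c *: x + y) `<=` d)%fset.
  apply: fsubset_trans (msuppD_le _ _) _; rewrite fsubUset sy andbT.
  exact: fsubset_trans (msuppZ_le _ _) sx.
rewrite (mlinEw f sx) (mlinEw f sy) (mlinEw f scxy) scaler_sumr -big_split /=.
by apply: eq_bigr => m _; rewrite mcoeffD mcoeffZ scalerDl scalerA.
Qed.
HB.instance Definition _ (V : lmodType K) (f : M -> V) :=
  GRing.isLinear.Build K monoid_alg V *:%R (mlin f) (mlin_is_linear f).

Fact mlin_base (V : lmodType K) (f : M -> V) m : mlin f (mbase m) = f m.
Proof.
rewrite (mlinEw f (msuppU_le (k := m) (x := 1))) big_seq_fset1.
by rewrite mcoeffUU scale1r.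
Qed.

Fact mbase_gen (x : monoid_alg) : x = mlin mbase x.
Proof.
rewrite {1}[x]monalgE /mlin; apply: eq_bigr => m _.
by apply/malgP => k; rewrite mcoeffZ !mcoeffU mulrnAr mulr1.
Qed.

Fact mlin_ext (V : lmodType K) (f g : {linear monoid_alg -> V}) :
  (forall m, f (mbase m) = g (mbase m)) -> f =1 g.
Proof.
move=> fg x; rewrite [x]mbase_gen /mlin !linear_sum.
by apply: eq_bigr => m _; rewrite !linearZ /= fg.
Qed.

Definition mone : monoid_alg := mbase 1%g.
Definition mmult (x y : monoid_alg) : monoid_alg :=
  mlin (fun m => mlin (fun m' => mbase (m * m')%g) y) x.

Definition mmultr y x := mmult x y.

Fact mmult_linearl y : linear (mmultr y).
Proof. by move=> c x x'; rewrite /mmultr /mmult linearP. Qed.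
Fact mmult_linearr x : linear (mmult x).
Proof.
have mmultE z : mmult x z =
    \sum_(m <- msupp x) x@_m *: mlin (fun m' => mbase (m * m')%g) z by [].
move=> c y y'; rewrite !mmultE scaler_sumr -big_split /=; apply: eq_bigr => m _.
by rewrite linearP scalerDr !scalerA mulrC.
Qed.
HB.instance Definition _ y :=
  GRing.isLinear.Build K monoid_alg monoid_alg *:%R (mmultr y) (mmult_linearl y).
HB.instance Definition _ x :=
  GRing.isLinear.Build K monoid_alg monoid_alg *:%R (mmult x) (mmult_linearr x).

Fact mmult_base m m' : mmult (mbase m) (mbase m') = mbase (m * m')%g.
Proof. by rewrite /mmult !mlin_base. Qed.

Fact mmultDl : left_distributive mmult +%R.
Proof. by move=> x y z; apply: (linearD (mmultr z)). Qed.
Fact mmultDr : right_distributive mmult +%R.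
Proof. by move=> x y z; apply: (linearD (mmult x)). Qed.
Fact mmultZl c x y : mmult (c *: x) y = c *: mmult x y.
Proof. exact: (linearZ_LR (mmultr y)). Qed.
Fact mmultZr c x y : mmult x (c *: y) = c *: mmult x y.
Proof. exact: (linearZ_LR (mmult x)). Qed.

Fact mmult1x : left_id mone mmult.
Proof.
move=> x; apply: (mlin_ext (f := mmult mone) (g := idfun)) => m.
by rewrite /= /mone mmult_base mul1g.
Qed.
Fact mmultx1 : right_id mone mmult.
Proof.
move=> x; apply: (mlin_ext (f := mmultr mone) (g := idfun)) => m.
by rewrite /= /mmultr /mone mmult_base mulg1.
Qed.
Fact mmultA : associative mmult.
Proof.
move=> x y z.
apply: (mlin_ext (f := mmultr (mmult y z)) (g := mmultr z \o mmultr y)) => m /=.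
apply: (mlin_ext (f := mmult (mbase m) \o mmultr z)
                 (g := mmultr z \o mmult (mbase m))) => m' /=.
apply: (mlin_ext (f := mmult (mbase m) \o mmult (mbase m'))
                 (g := mmult (mmult (mbase m) (mbase m')))) => m'' /=.
by rewrite /= /mmultr !mmult_base mulgA.
Qed.

HB.instance Definition _ := GRing.Zmodule_isPzRing.Build monoid_alg
  mmultA mmult1x mmultx1 mmultDl mmultDr.

Definition mscal (a : K) : monoid_alg := a *: mone.
Fact mscal_is_zmod_morphism : zmod_morphism mscal.
Proof. by move=> a b; rewrite /mscal scalerBl. Qed.
Fact mscal_is_monoid_morphism : monoid_morphism mscal.
Proof.
split=> [|a b]; rewrite /mscal ?scale1r //.
by rewrite [RHS]mmultZl mmultZr mmult1x scalerA.
Qed.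
Fact mscalC (a : K) (x : monoid_alg) : mscal a * x = x * mscal a.
Proof. by rewrite [LHS]mmultZl [RHS]mmultZr mmult1x mmultx1. Qed.
HB.instance Definition _ := isPzAlgebra.Build K monoid_alg
  mscal_is_zmod_morphism mscal_is_monoid_morphism mscalC.

End MonoidAlgebra.

Arguments mbase {K M} m.

Definition word (X : choiceType) := seq X.
HB.instance Definition _ (X : choiceType) := Choice.on (word X).
HB.instance Definition _ (X : choiceType) :=
  isMonoid.Build (word X) (@catA X) (@cat0s X) (@cats0 X).

Definition free_alg (K : comNzRingType) (X : choiceType) := monoid_alg K (word X).
HB.instance Definition _ (K : comNzRingType) (X : choiceType) :=
  PzAlgebra.on (free_alg K X).

Definition gen {K : comNzRingType} {X : choiceType} (x : X) : free_alg K X :=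
  mbase ([:: x] : word X).

(* [U(L)]: the linear relators turn the free algebra on the set [L] into the
   tensor algebra of the vector space [L]. *)
Section Envelope.
Variables (K : comNzRingType) (L : lieAlgType K).

Inductive envelope_rel : free_alg K L -> Prop :=
| EnvLinear (a : K) (x y : L) :
    envelope_rel (gen (a *: x + y) - (scal a * gen x + gen y))
| EnvBracket (x y : L) :
    envelope_rel (gen x * gen y - gen y * gen x - gen (lie x y)).

Definition envelope := quot_alg envelope_rel.
HB.instance Definition _ := PzAlgebra.on envelope.

Definition env_in (x : L) : envelope := quot_pi envelope_rel (gen x).

End Envelope.

Section Tensor.
Variables (K : comNzRingType) (A B : palgType K).

Definition mul_pair := (A * B)%type.
HB.instance Definition _ := Choice.on mul_pair.
Definition pair_mul (x y : mul_pair) : mul_pair := (x.1 * y.1, x.2 * y.2).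
Definition pair_one : mul_pair := (1, 1).
Fact pair_mulA : associative pair_mul.
Proof. by move=> x y z; rewrite /pair_mul /= !mulrA. Qed.
Fact pair_mul1 : left_id pair_one pair_mul.
Proof. by case=> a b; rewrite /pair_mul /= !mul1r. Qed.
Fact pair_1mul : right_id pair_one pair_mul.
Proof. by case=> a b; rewrite /pair_mul /= !mulr1. Qed.
HB.instance Definition _ :=
  isMonoid.Build mul_pair pair_mulA pair_mul1 pair_1mul.

(* The free module on the set [A * B] with [(a, b) (a', b') = (a a', b b')], modulo
   bilinearity.  Multiplying a relator by a basis element on either side gives a
   relator of the same kind, so the two-sided ideal they generate is their
   linear span, and the underlying module is the usual tensor product. *)
Local Notation pt a b := (mbase ((a, b) : mul_pair) : monoid_alg K mul_pair).

Inductive bilinear_rel : monoid_alg K mul_pair -> Prop :=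
| BilinDl (a a' : A) (b : B) : bilinear_rel (pt (a + a') b - (pt a b + pt a' b))
| BilinDr (a : A) (b b' : B) : bilinear_rel (pt a (b + b') - (pt a b + pt a b'))
| BilinZl (c : K) (a : A) (b : B) : bilinear_rel (pt (scal c * a) b - scal c * pt a b)
| BilinZr (c : K) (a : A) (b : B) : bilinear_rel (pt a (scal c * b) - scal c * pt a b).

Definition tensor := quot_alg bilinear_rel.
HB.instance Definition _ := PzAlgebra.on tensor.

Definition tens (a : A) (b : B) : tensor :=
  quot_pi bilinear_rel (mbase ((a, b) : mul_pair)).

End Tensor.

Notation "a ⊗ b" := (tens a b) (at level 40, left associativity) : ring_scope.

Section Weyl.
Variables (K : comNzRingType) (n : nat).

Local Notation F := (free_alg K ('I_n + 'I_n)%type).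
Local Notation wt i := (gen (inl i) : F).
Local Notation wd i := (gen (inr i) : F).

Inductive weyl_rel : F -> Prop :=
| WeylTT (i j : 'I_n) : weyl_rel (wt i * wt j - wt j * wt i)
| WeylDD (i j : 'I_n) : weyl_rel (wd i * wd j - wd j * wd i)
| WeylDT (i j : 'I_n) : weyl_rel (wd i * wt j - wt j * wd i - scal (i == j)%:R).

Definition weyl := quot_alg weyl_rel.
HB.instance Definition _ := PzAlgebra.on weyl.

Definition weyl_t (i : 'I_n) : weyl := quot_pi weyl_rel (gen (inl i)).
Definition weyl_d (i : 'I_n) : weyl := quot_pi weyl_rel (gen (inr i)).

End Weyl.

(* Entries of linear combinations, leaving matrix products folded for [ring]. *)
Fact mxlinE (K : pzRingType) (m n : nat) :
  (forall (A B : 'M[K]_(m, n)) i j, (A + B)%R i j = A i j + B i j)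
  * (forall (A : 'M[K]_(m, n)) i j, (- A)%R i j = - A i j)
  * (forall a (A : 'M[K]_(m, n)) i j, (a *: A)%R i j = a * A i j)
  * (forall i j, (0 : 'M[K]_(m, n)) i j = 0).
Proof. by do !split=> *; rewrite mxE. Qed.

Fact trmxlinE (K : pzRingType) (m n : nat) :
  (forall A B : 'M[K]_(m, n), (A + B)%R^T = A^T + B^T)
  * (forall A : 'M[K]_(m, n), (- A)%R^T = - A^T).
Proof. by split=> *; apply/matrixP => i j; rewrite !mxE. Qed.

Section Symplectic.
Variables (K : comNzRingType) (n : nat).

Definition sp_pred : {pred 'M[K]_(n + n)} := fun M =>
  [&& drsubmx M == - (ulsubmx M)^T, ursubmx M == (ursubmx M)^T
    & dlsubmx M == (dlsubmx M)^T].

Fact sp_block (M : 'M[K]_(n + n)) : M \in sp_pred ->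
  exists A B C : 'M[K]_n,
    [/\ M = block_mx A B C (- A^T), B^T = B & C^T = C].
Proof.
case/and3P=> /eqP MD /eqP MB /eqP MC.
exists (ulsubmx M), (ursubmx M), (dlsubmx M).
by rewrite -MB -MC -MD submxK.
Qed.

Fact block_sp (A B C : 'M[K]_n) :
  B^T = B -> C^T = C -> block_mx A B C (- A^T) \in sp_pred.
Proof.
move=> BT CT; rewrite unfold_in /=.
by rewrite block_mxKul block_mxKur block_mxKdl block_mxKdr BT CT !eqxx.
Qed.

Fact sp_submod_closed : submod_closed sp_pred.
Proof.
split=> [|c _ _ /sp_block[A [B [C [-> BT CT]]]] /sp_block[A' [B' [C' [-> BT' CT']]]]].
  by rewrite -(block_mx0 K n n n n) -{4}oppr0 -{4}trmx0 block_sp ?trmx0.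
rewrite scale_block_mx add_block_mx scalerN -opprD -linearZ -linearD /=.
by rewrite block_sp // linearD linearZ /= ?BT ?CT ?BT' ?CT'.
Qed.
HB.instance Definition _ :=
  GRing.isSubmodClosed.Build K 'M[K]_(n + n) sp_pred sp_submod_closed.

Record sp := Sp { sp_val : 'M[K]_(n + n); _ : sp_val \in sp_pred }.
HB.instance Definition _ := [isSub for sp_val].
HB.instance Definition _ := [Choice of sp by <:].
HB.instance Definition _ := [SubChoice_isSubLmodule of sp by <:].

Fact sp_lie_subproof (X Y : sp) :
  sp_val X *m sp_val Y - sp_val Y *m sp_val X \in sp_pred.
Proof.
case: X Y => [X /= /sp_block[A [B [C [-> BT CT]]]]].
case=> [Y /= /sp_block[A' [B' [C' [-> BT' CT']]]]].
rewrite !mulmx_block opp_block_mx add_block_mx.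
set D := (X in block_mx _ _ _ X).
suff -> : D = - (A *m A' + B *m C' - (A' *m A + B' *m C))^T.
  apply: block_sp; rewrite !trmxlinE !trmx_mul ?trmxlinE ?trmxK ?BT ?CT ?BT' ?CT';
    rewrite ?(mulNmx, mulmxN); by apply/matrixP => i j; rewrite !mxlinE; ring.
rewrite /D !trmxlinE !trmx_mul ?BT ?CT ?BT' ?CT' ?(mulNmx, mulmxN).
by apply/matrixP => i j; rewrite !mxlinE; ring.
Qed.

Definition sp_lie (X Y : sp) : sp := Sp (sp_lie_subproof X Y).

Fact sp_lie_linearl (a : K) (x y z : sp) :
  sp_lie (a *: x + y) z = a *: sp_lie x z + sp_lie y z.
Proof.
apply: val_inj; rewrite /= mulmxDl mulmxDr -scalemxAl -scalemxAr.
by apply/matrixP => i j; rewrite !mxlinE; ring.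
Qed.
Fact sp_lie_linearr (a : K) (x y z : sp) :
  sp_lie x (a *: y + z) = a *: sp_lie x y + sp_lie x z.
Proof.
apply: val_inj; rewrite /= mulmxDl mulmxDr -scalemxAl -scalemxAr.
by apply/matrixP => i j; rewrite !mxlinE; ring.
Qed.
Fact sp_lie_alt (x : sp) : sp_lie x x = 0.
Proof. by apply: val_inj; rewrite /= subrr. Qed.
Fact sp_lie_jacobi (x y z : sp) :
  sp_lie x (sp_lie y z) + sp_lie y (sp_lie z x) + sp_lie z (sp_lie x y) = 0.
Proof.
apply: val_inj => /=; rewrite !(mulmxBl, mulmxBr) !mulmxA.
by apply/matrixP => i j; rewrite !mxlinE; ring.
Qed.
HB.instance Definition _ := isLieAlgebra.Build K sp
  sp_lie_linearl sp_lie_linearr sp_lie_alt sp_lie_jacobi.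

End Symplectic.

Section Heisenberg.
Variables (K : comNzRingType) (n : nat).

(* [(v, c)] stands for [v + c z]. *)
Definition heis := ('cV[K]_(n + n) * K^o)%type.
HB.instance Definition _ := GRing.Lmodule.on heis.

(* The form with [[e_i, e_(n+i)] = z] and all other brackets of basis vectors
   zero, up to antisymmetry. *)
Definition heis_form (v w : 'cV[K]_(n + n)) : K :=
  \sum_(i < n) (v (lshift n i) 0 * w (rshift n i) 0
              - v (rshift n i) 0 * w (lshift n i) 0).

Definition heis_lie (h k : heis) : heis := (0, heis_form h.1 k.1).

Fact heis_form_linearl a u v w :
  heis_form (a *: u + v) w = a * heis_form u w + heis_form v w.
Proof.
rewrite /heis_form mulr_sumr -big_split /=; apply: eq_bigr => i _.
by rewrite !mxE; ring.
Qed.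
Fact heis_form_linearr a u v w :
  heis_form u (a *: v + w) = a * heis_form u v + heis_form u w.
Proof.
rewrite /heis_form mulr_sumr -big_split /=; apply: eq_bigr => i _.
by rewrite !mxE; ring.
Qed.
Fact heis_formvv v : heis_form v v = 0.
Proof. by rewrite /heis_form big1 // => i _; ring. Qed.
Fact heis_formC v w : heis_form v w = - heis_form w v.
Proof. by rewrite /heis_form -sumrN; apply: eq_bigr => i _; ring. Qed.
Fact heis_form0l v : heis_form 0 v = 0.
Proof. by rewrite /heis_form big1 // => i _; rewrite !mxE; ring. Qed.
Fact heis_form0r v : heis_form v 0 = 0.
Proof. by rewrite heis_formC heis_form0l oppr0. Qed.
Fact heis_formBr u v w : heis_form u (v - w) = heis_form u v - heis_form u w.
Proof.
by rewrite addrC -scaleN1r heis_form_linearr mulN1r addrC.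
Qed.

Fact heis_lie_linearl (a : K) (x y z : heis) :
  heis_lie (a *: x + y) z = a *: heis_lie x z + heis_lie y z.
Proof.
congr pair; last exact: heis_form_linearl.
by rewrite /= scaler0 addr0.
Qed.
Fact heis_lie_linearr (a : K) (x y z : heis) :
  heis_lie x (a *: y + z) = a *: heis_lie x y + heis_lie x z.
Proof.
congr pair; last exact: heis_form_linearr.
by rewrite /= scaler0 addr0.
Qed.
Fact heis_lie_alt (x : heis) : heis_lie x x = 0.
Proof. by rewrite /heis_lie heis_formvv. Qed.
Fact heis_lie_jacobi (x y z : heis) :
  heis_lie x (heis_lie y z) + heis_lie y (heis_lie z x)
    + heis_lie z (heis_lie x y) = 0.
Proof. by rewrite /heis_lie /= !heis_form0r; congr pair; rewrite /= !addr0. Qed.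
HB.instance Definition _ := isLieAlgebra.Build K heis
  heis_lie_linearl heis_lie_linearr heis_lie_alt heis_lie_jacobi.

End Heisenberg.

Section Oscillator.
Variables (K : comNzRingType) (n : nat).

Definition heis_act (X : sp K n) (h : heis K n) : heis K n :=
  (sp_val X *m h.1, 0).

(* The semidirect product; [(X, h)] stands for [X + h]. *)
Definition osc := (sp K n * heis K n)%type.
HB.instance Definition _ := GRing.Lmodule.on osc.

Definition osc_lie (x y : osc) : osc :=
  (lie x.1 y.1, lie x.2 y.2 + heis_act x.1 y.2 - heis_act y.1 x.2).

Fact heis_form_sp (X : sp K n) v w :
  heis_form v (sp_val X *m w) = heis_form w (sp_val X *m v).
Proof.
have formE (x y : 'cV[K]_(n + n)) : heis_form x y =
    ((usubmx x)^T *m dsubmx y - (dsubmx x)^T *m usubmx y) 0 0.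
  by rewrite /heis_form sumrB !mxE; congr (_ - _); apply: eq_bigr => i _;
     rewrite !mxE.
have tr1 (M : 'M[K]_1) : M 0 0 = M^T 0 0 by rewrite mxE.
case: X => X /= /sp_block[A [B [C [-> BT CT]]]].
rewrite 2!formE -[v]vsubmxK -[w]vsubmxK.
move: (usubmx v) (dsubmx v) (usubmx w) (dsubmx w) => v1 v2 w1 w2.
rewrite !mul_block_col !col_mxKu !col_mxKd [RHS]tr1; congr (fun_of_matrix _ 0 0).
rewrite !trmxlinE !trmx_mul !trmxlinE !trmx_mul !trmxlinE !trmxK BT CT.
rewrite !(mulmxDl, mulmxDr) !(mulmxN, mulNmx) -!mulmxA ?(mulmxN, mulNmx).
by apply/matrixP => i j; rewrite !mxlinE; ring.
Qed.

Fact osc_lieE (x y : osc) : osc_lie x y =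
  (lie x.1 y.1, (sp_val x.1 *m y.2.1 - sp_val y.1 *m x.2.1,
                 heis_form x.2.1 y.2.1)).
Proof.
congr (_, (_, _)); first by rewrite /= add0r.
by rewrite /= addr0 subr0.
Qed.

Fact osc_lie_linearl (a : K) (x y z : osc) :
  osc_lie (a *: x + y) z = a *: osc_lie x z + osc_lie y z.
Proof.
rewrite !osc_lieE; congr (_, (_, _)); first exact: lie_linearl.
  rewrite /= mulmxDl mulmxDr -scalemxAl -scalemxAr.
  by apply/matrixP => i j; rewrite !mxlinE; ring.
exact: heis_form_linearl.
Qed.
Fact osc_lie_linearr (a : K) (x y z : osc) :
  osc_lie x (a *: y + z) = a *: osc_lie x y + osc_lie x z.
Proof.
rewrite !osc_lieE; congr (_, (_, _)); first exact: lie_linearr.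
  rewrite /= mulmxDl mulmxDr -scalemxAl -scalemxAr.
  by apply/matrixP => i j; rewrite !mxlinE; ring.
exact: heis_form_linearr.
Qed.
Fact osc_lie_alt (x : osc) : osc_lie x x = 0.
Proof. by rewrite osc_lieE lie_alt subrr heis_formvv. Qed.
Fact osc_lie_jacobi (x y z : osc) :
  osc_lie x (osc_lie y z) + osc_lie y (osc_lie z x) + osc_lie z (osc_lie x y) = 0.
Proof.
rewrite !osc_lieE; congr (_, (_, _)); first exact: lie_jacobi.
  rewrite /= !(mulmxBl, mulmxBr) !mulmxA.
  by apply/matrixP => i j; rewrite !mxlinE; ring.
rewrite /= !heis_formBr.
rewrite (heis_form_sp y.1 x.2.1) (heis_form_sp z.1 x.2.1) (heis_form_sp x.1 y.2.1).
ring.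
Qed.
HB.instance Definition _ := isLieAlgebra.Build K osc
  osc_lie_linearl osc_lie_linearr osc_lie_alt osc_lie_jacobi.

Definition osc_sp (X : sp K n) : osc := (X, 0).
Definition osc_v (v : 'cV[K]_(n + n)) : osc := (0, (v, 0)).
Definition osc_z : osc := (0, (0, 1)).

End Oscillator.

Section RootVectors.
Variables (K : comNzRingType) (n : nat) (i j : 'I_n).

Local Notation u k := (lshift n k).
Local Notation d k := (rshift n k).
Local Notation E k l := (delta_mx k l).

Let deltaE := (eq_lshift, eq_rshift, eq_lrshift, eq_rlshift).

Fact root_h_subproof : E (u i) (u i) - E (d i) (d i) \in @sp_pred K n.
Proof.
rewrite unfold_in; apply/and3P; split; apply/eqP/matrixP => k l;
  rewrite !mxE !deltaE ?andbF /=; by do ?[rewrite andbC; ring | ring].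
Qed.
Fact root_pm_subproof : E (u i) (u j) - E (d j) (d i) \in @sp_pred K n.
Proof.
rewrite unfold_in; apply/and3P; split; apply/eqP/matrixP => k l;
  rewrite !mxE !deltaE ?andbF /=; by do ?[rewrite andbC; ring | ring].
Qed.
Fact root_pp_subproof : E (u i) (d j) + E (u j) (d i) \in @sp_pred K n.
Proof.
rewrite unfold_in; apply/and3P; split; apply/eqP/matrixP => k l;
  rewrite !mxE !deltaE ?andbF /= ?[(l == _) && _]andbC; ring.
Qed.
Fact root_mm_subproof : E (d i) (u j) + E (d j) (u i) \in @sp_pred K n.
Proof.
rewrite unfold_in; apply/and3P; split; apply/eqP/matrixP => k l;
  rewrite !mxE !deltaE ?andbF /= ?[(l == _) && _]andbC; ring.
Qed.

Definition root_h : sp K n := Sp root_h_subproof.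
(* [X_(eps_i - eps_j)], [X_(eps_i + eps_j)] and [X_(- eps_i - eps_j)];
   the first is meant for [i != j]. *)
Definition root_pm : sp K n := Sp root_pm_subproof.
Definition root_pp : sp K n := Sp root_pp_subproof.
Definition root_mm : sp K n := Sp root_mm_subproof.

(* [X_(eps_i)] and [X_(- eps_i)] *)
Definition root_p : osc K n := osc_v (delta_mx (u i) 0).
Definition root_m : osc K n := osc_v (delta_mx (d i) 0).

End RootVectors.

(* [<z - zdot>] in [U(g_n)] *)
Section CentralQuotient.
Variables (K : comNzRingType) (n : nat) (zdot : K).

Definition central_rel (x : envelope (osc K n)) : Prop :=
  x = env_in (osc_z K n) - scal zdot.

Definition env_osc_quot := quot_alg central_rel.
HB.instance Definition _ := PzAlgebra.on env_osc_quot.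

Definition osc_class (x : osc K n) : env_osc_quot :=
  quot_pi central_rel (env_in x).

End CentralQuotient.

(* Main.v *)
Require Import Defs.
From HB Require Import structures.
From mathcomp Require Import all_boot all_algebra.
From mathcomp Require Import boolp ring.
From mathcomp Require Import reals complex.

Import GRing.Theory.
Local Open Scope ring_scope.
Local Open Scope complex_scope.

(** Both algebras solve the same universal problem, and this is what makes them
    isomorphic.  Write [s] for the square root of [zdot], [e_i] for the standard
    basis and [w(u, v)] for the form on [K^(2n)] that gives the Heisenberg
    bracket.

    A morphism from [U(g_n)/<z - zdot>] to an algebra [A] is a linear map
    [c : g_n -> A] that turns brackets into commutators and sends [z] to [s^2]
    ([env_osc_quot_lift]).  A morphism from [U(sp_2n) ⊗ D_n] to [A] is a pair of
    linear maps [rho : sp_2n -> A] and [q : K^(2n) -> A] such that [rho] turns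
    brackets into commutators, [[q u, q v] = w(u, v)], and the two images
    commute ([tensor_envelope_weyl_lift]); for the Weyl algebra itself, [q] is
    [weyl_vec], with [e_i] sent to [t_i] and [e_(n+i)] to [-d_i].

    The two kinds of data determine each other.  Given [q], each [X] in [sp_2n]
    has a quadratic element
      [Q(X) = 1/2 sum_i (q(X e_(n+i)) q(e_i) - q(X e_i) q(e_(n+i)))],
    called [metaplectic] below, and
      [[Q(X), q(v)] = q(X v)],   [[Q(X), Q(Y)] = Q([X, Y])].
    The first identity is a computation with [w]; the second follows from it
    because [X] kills the bivector [sum_i e_(n+i) ∧ e_i]
    ([symplectic_contraction_inv]).  Hence a pair [(rho, q)] gives
    [c(X + v + a z) = rho(X) + Q(X) + s q(v) + s^2 a] ([osc_rep]).  In the other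
    direction, [c] gives [q(v) = c(v)/s] ([heis_part]) and
    [rho(X) = c(X) - Q(X)] ([sp_part]): since [c(X)] and [Q(X)] have the same
    commutators with all [q(v)], the difference commutes with them, hence also
    with every [Q(Y)], and this makes [rho] a Lie morphism.

    The two passages are inverse to each other and natural in [A].  Applied to
    the universal data on the two sides they produce the morphism of the theorem
    and its inverse ([osc_rep_bijective]).  Its values on root vectors are the
    values of [Q] on matrix units; the constant [1/2] in the image of [h_i] is
    what remains of the symmetric ordering of [t_i d_i]. *)

(** * Commutators *)

Definition commutator {A : pzRingType} (x y : A) : A := x * y - y * x.

Section Commutator.
Context {K : pzRingType} {A : palgType K}.
Implicit Types x y z : A.

Lemma commutatorC x y : commutator x y = - commutator y x.
Proof. by rewrite /commutator opprB. Qed.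
Lemma commutatorDl x y z : commutator (x + y) z = commutator x z + commutator y z.
Proof. by rewrite /commutator mulrDl mulrDr opprD addrACA. Qed.
Lemma commutatorNl x z : commutator (- x) z = - commutator x z.
Proof. by rewrite /commutator mulNr mulrN opprK opprB addrC. Qed.
Lemma commutatorBl x y z : commutator (x - y) z = commutator x z - commutator y z.
Proof. by rewrite commutatorDl commutatorNl. Qed.
Lemma commutatorDr x y z : commutator x (y + z) = commutator x y + commutator x z.
Proof. by rewrite !(commutatorC x) commutatorDl opprD. Qed.
Lemma commutatorNr x y : commutator x (- y) = - commutator x y.
Proof. by rewrite !(commutatorC x) commutatorNl. Qed.
Lemma commutatorBr x y z : commutator x (y - z) = commutator x y - commutator x z.
Proof. by rewrite commutatorDr commutatorNr. Qed.
Lemma commutator_suml I (r : seq I) (F : I -> A) z :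
  commutator (\sum_(i <- r) F i) z = \sum_(i <- r) commutator (F i) z.
Proof. by rewrite /commutator mulr_suml mulr_sumr -sumrB. Qed.
Lemma commutator_sumr I (r : seq I) (F : I -> A) z :
  commutator z (\sum_(i <- r) F i) = \sum_(i <- r) commutator z (F i).
Proof. by rewrite /commutator mulr_suml mulr_sumr -sumrB. Qed.
Lemma commutatorMl x y z :
  commutator (x * y) z = x * commutator y z + commutator x z * y.
Proof. by rewrite /commutator mulrBr mulrBl !mulrA addrA subrK. Qed.
Lemma commutatorMr x y z :
  commutator x (y * z) = commutator x y * z + y * commutator x z.
Proof. by rewrite /commutator mulrBr mulrBl !mulrA addrA subrK. Qed.
Lemma commutator_scall (a : K) z : commutator (scal a) z = 0.
Proof. by rewrite /commutator scalC subrr. Qed.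
Lemma commutator_scalr (a : K) z : commutator z (scal a) = 0.
Proof. by rewrite /commutator scalC subrr. Qed.
Lemma commutatorZl (a : K) x y : commutator (scal a * x) y = scal a * commutator x y.
Proof. by rewrite commutatorMl commutator_scall mul0r addr0. Qed.
Lemma commutatorZr (a : K) x y : commutator x (scal a * y) = scal a * commutator x y.
Proof. by rewrite commutatorMr commutator_scalr mul0r add0r. Qed.
End Commutator.

Lemma commute_commutator0 {A : pzRingType} (x y : A) :
  GRing.comm x y <-> commutator x y = 0.
Proof.
rewrite /GRing.comm /commutator; split=> [->|/eqP]; first by rewrite subrr.
by rewrite subr_eq0 => /eqP.
Qed.

(** * Subalgebras *)

(** Taken as the motive of an induction on generators: a property of elements
    stable under the algebra operations holds everywhere once it holds on
    generators. *)
Definition subalgebra {K : pzRingType} {A : palgType K} (P : A -> Prop) : Prop :=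
  [/\ forall a : K, P (scal a),
      forall x y, P x -> P y -> P (x + y) &
      forall x y, P x -> P y -> P (x * y)].

Lemma subalgebra_cancel {K : pzRingType} {A B : palgType K}
    (f : {rmorphism A -> B}) (g : {rmorphism B -> A}) :
  (forall a : K, f (scal a) = scal a) -> (forall a : K, g (scal a) = scal a) ->
  subalgebra (fun x => g (f x) = x).
Proof.
move=> fscal gscal; split=> [a|x y gfx gfy|x y gfx gfy].
- by rewrite fscal gscal.
- by rewrite !rmorphD gfx gfy.
- by rewrite !rmorphM gfx gfy.
Qed.

Lemma subalgebra_preim {K : pzRingType} {A B : palgType K}
    (f : {rmorphism A -> B}) (P : B -> Prop) :
  (forall a : K, f (scal a) = scal a) ->
  subalgebra P -> subalgebra (fun x => P (f x)).
Proof.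
move=> fscal [Pscal PD PM]; split=> [a|x y|x y].
- by rewrite fscal.
- by rewrite rmorphD; apply: PD.
- by rewrite rmorphM; apply: PM.
Qed.

Lemma subalgebra_comm {K : pzRingType} {A : palgType K} (y : A) :
  subalgebra (fun x : A => GRing.comm x y).
Proof.
split=> [a|x x' cx cx'|x x' cx cx'].
- exact: scalC.
- exact/commr_sym/commrD/commr_sym.
- exact/commr_sym/commrM/commr_sym.
Qed.

(** * Quotients by relators *)

Lemma rmorph_commutator {A B : pzRingType} (f : {rmorphism A -> B}) (x y : A) :
  f (commutator x y) = commutator (f x) (f y).
Proof. by rewrite /commutator rmorphB !rmorphM. Qed.

Lemma rmorph_commutatorE {A B : pzRingType} {f : {rmorphism A -> B}} {x y : A}
    {p q : B} :
  f x = p -> f y = q -> f (x * y - y * x) = commutator p q.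
Proof. by move=> <- <-; exact: rmorph_commutator. Qed.

Section QuotientRelations.
Context {K : pzRingType} {A : palgType K} {S : A -> Prop}.
Local Notation pi := (quot_pi S).

Lemma quot_rel x y : S (x - y) -> pi x = pi y.
Proof. by move=> Sxy; apply/quot_piP/asboolP => I _; apply. Qed.

Lemma quot_commutator0 x y : S (x * y - y * x) -> commutator (pi x) (pi y) = 0.
Proof.
rewrite -rmorph_commutator -(rmorph0 pi) => Sxy.
by apply: quot_rel; rewrite subr0.
Qed.

Lemma quot_commutator x y z :
  S (x * y - y * x - z) -> commutator (pi x) (pi y) = pi z.
Proof. by rewrite -rmorph_commutator; exact: quot_rel. Qed.

Lemma quot_piZ (c : K) x : pi (scal c * x) = scal c * pi x.
Proof. exact: rmorphM. Qed.
End QuotientRelations.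

(** The kernel of [f] is a two-sided ideal that contains the relators, so it
    contains the ideal they generate. *)
Lemma quot_lift {K : pzRingType} {A B : palgType K} {S : A -> Prop}
    (f : {rmorphism A -> B}) :
  (forall y, S y -> f y = 0) ->
  exists F : {rmorphism quot_alg S -> B}, forall x, F (quot_pi S x) = f x.
Proof.
move=> fS.
have f_ideal x y : x - y \in ideal_gen S -> f x = f y.
  move=> /asboolP/(_ (fun x => f x = 0)) fxy; apply/eqP; rewrite -subr_eq0 -rmorphB.
  apply/eqP/fxy => //; split=> [|u v fu fv|a u fu|a u fu].
  - exact: rmorph0.
  - by rewrite rmorphB fu fv subr0.
  - by rewrite rmorphM fu mulr0.
  - by rewrite rmorphM fu mul0r.
pose F (p : quot_alg S) : B := f (repr p).
have FE x : F (quot_pi S x) = f x by apply/f_ideal/quot_pi_repr.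
have FB : zmod_morphism F.
  move=> p q; rewrite -[p]quot_piK -[q]quot_piK.
  by rewrite -raddfB !FE rmorphB.
have FM : monoid_morphism F.
  split=> [|p q]; first by rewrite -(rmorph1 (quot_pi S)) FE rmorph1.
  by rewrite -[p]quot_piK -[q]quot_piK -rmorphM !FE rmorphM.
pose FR : {rmorphism quot_alg S -> B} := HB.pack F
  (GRing.isZmodMorphism.Build _ _ F FB) (GRing.isMonoidMorphism.Build _ _ F FM).
by exists FR.
Qed.

Lemma quot_ind {K : pzRingType} {A : palgType K} {S : A -> Prop}
    (P : quot_alg S -> Prop) :
  (forall x, P (quot_pi S x)) -> forall p, P p.
Proof. by move=> PS p; rewrite -[p]quot_piK. Qed.

(** * Monoid algebras and free algebras *)

(** The algebra [A] as a [K]-module through [scal], so that it can be the target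
    of the linear extension [mlin]. *)
Definition module_of {K : pzRingType} (A : palgType K) : Type := A.
HB.instance Definition _ (K : pzRingType) (A : palgType K) :=
  GRing.Zmodule.on (module_of A).
Section ModuleOf.
Variables (K : pzRingType) (A : palgType K).
Let scale (a : K) (x : module_of A) : module_of A := scal a * (x : A).
Fact module_of_scaleA a b x : scale a (scale b x) = scale (a * b) x.
Proof. by rewrite /scale rmorphM mulrA. Qed.
Fact module_of_scale1 : left_id 1 scale.
Proof. by move=> x; rewrite /scale rmorph1 mul1r. Qed.
Fact module_of_scaleDr : right_distributive scale +%R.
Proof. by move=> a x y; rewrite /scale; exact: (@mulrDr A). Qed.
Fact module_of_scaleDl x : {morph scale^~ x : a b / a + b}.
Proof. by move=> a b; rewrite /scale rmorphD; exact: (@mulrDl A). Qed.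
HB.instance Definition _ := GRing.Zmodule_isLmodule.Build K (module_of A)
  module_of_scaleA module_of_scale1 module_of_scaleDr module_of_scaleDl.
End ModuleOf.

Lemma monoid_alg_scale {K : comNzRingType} {M : monoidType} (a : K)
  (x : monoid_alg K M) : scal a * x = a *: x.
Proof. by rewrite [LHS]mmultZl mmult1x. Qed.

Lemma monoid_alg_ind {K : comNzRingType} {M : monoidType}
    (P : monoid_alg K M -> Prop) :
  (forall x y, P x -> P y -> P (x + y)) ->
  (forall (a : K) m, P (scal a * mbase m)) -> forall x, P x.
Proof.
move=> PD PZ x; rewrite [x]mbase_gen; apply: big_ind => [||m _].
- by have := PZ 0 1%g; rewrite rmorph0 mul0r.
- exact: PD.
- by rewrite -monoid_alg_scale.
Qed.

Lemma scal_mulACA {K : pzRingType} {A : palgType K} (a b : K) (x y : A) :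
  (scal a * x) * (scal b * y) = scal a * (scal b * (x * y)).
Proof. by rewrite -!mulrA; congr (_ * _); rewrite mulrA -scalC mulrA. Qed.

(** Both sides of [F (x * y) = F x * F y] are bilinear in [(x, y)], so a linear
    map is multiplicative as soon as it is on a spanning set. *)
Section Multiplicative.
Context {K : pzRingType} {A B : palgType K} {F : A -> B}.
Hypothesis FD : forall x y, F (x + y) = F x + F y.
Hypothesis FZ : forall (a : K) x, F (scal a * x) = scal a * F x.

Lemma multiplicativeDl x x' y :
  F (x * y) = F x * F y -> F (x' * y) = F x' * F y ->
  F ((x + x') * y) = F (x + x') * F y.
Proof. by rewrite mulrDl !FD mulrDl => -> ->. Qed.
Lemma multiplicativeDr x y y' :
  F (x * y) = F x * F y -> F (x * y') = F x * F y' ->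
  F (x * (y + y')) = F x * F (y + y').
Proof. by rewrite mulrDr !FD mulrDr => -> ->. Qed.
Lemma multiplicativeZ a b x y :
  F (x * y) = F x * F y ->
  F ((scal a * x) * (scal b * y)) = F (scal a * x) * F (scal b * y).
Proof. by rewrite scal_mulACA !FZ scal_mulACA => ->. Qed.
End Multiplicative.

Lemma monoid_alg_lift {K : comNzRingType} {M : monoidType} {B : palgType K}
    (f : M -> B) :
  f 1%g = 1 -> {morph f : x y / (x * y)%g >-> x * y} ->
  exists F : {rmorphism monoid_alg K M -> B},
    (forall a : K, F (scal a) = scal a) /\ forall m, F (mbase m) = f m.
Proof.
move=> f1 fM.
pose F (x : monoid_alg K M) : B := mlin (f : M -> module_of B) x.
have Fbase m : F (mbase m) = f m := mlin_base (f : M -> module_of B) m.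
have FD x y : F (x + y) = F x + F y := linearD (mlin (f : M -> module_of B)) x y.
have FZ a x : F (scal a * x) = scal a * F x.
  by rewrite monoid_alg_scale; exact: (linearZ_LR (mlin (f : M -> module_of B))).
have F1 : F 1 = 1 by rewrite Fbase f1.
have FB : zmod_morphism F := linearB (mlin (f : M -> module_of B)).
(* From here on only linearity and the values on the basis matter. *)
clearbody F.
have FM : monoid_morphism F.
  split=> // x y; elim/(@monoid_alg_ind K M): x => [x x'|a m].
    exact: multiplicativeDl.
  elim/(@monoid_alg_ind K M): y => [y y'|b m']; first exact: multiplicativeDr.
  by apply: multiplicativeZ => //; rewrite [X in F X]mmult_base !Fbase fM.
pose FR : {rmorphism monoid_alg K M -> B} := HB.pack F
  (GRing.isZmodMorphism.Build _ _ F FB) (GRing.isMonoidMorphism.Build _ _ F FM).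
exists FR; split=> // a.
by rewrite -[scal a]mulr1 [LHS]FZ F1 mulr1.
Qed.

Lemma free_alg_lift {K : comNzRingType} {X : choiceType} {B : palgType K}
    (g : X -> B) :
  exists F : {rmorphism free_alg K X -> B},
    (forall a : K, F (scal a) = scal a) /\ forall x, F (gen x) = g x.
Proof.
have [||F [Fscal Fbase]] := @monoid_alg_lift K (word X) B
  (fun w => \prod_(x <- w) g x).
- exact: big_nil.
- by move=> v w; exact: big_cat.
by exists F; split=> // x; rewrite Fbase big_seq1.
Qed.

Lemma free_alg_ind {K : comNzRingType} {X : choiceType}
    (P : free_alg K X -> Prop) :
  subalgebra P -> (forall x, P (gen x)) -> forall u, P u.
Proof.
move=> [Pscal PD PM] Pgen.
apply: (@monoid_alg_ind K (word X) P) => [|a w]; first exact: PD.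
apply: (PM) => //; elim: w => [|x w IHw].
  by have := Pscal 1; rewrite rmorph1.
have -> : mbase (x :: w : word X) = gen x * mbase (w : word X) :> free_alg K X.
  by rewrite [RHS]mmult_base.
exact: PM.
Qed.

(** * Linear maps into an algebra *)

Definition scal_linear {K : pzRingType} {U : lmodType K} {A : palgType K}
    (f : U -> A) : Prop :=
  forall (a : K) x y, f (a *: x + y) = scal a * f x + f y.

Section ScalLinear.
Context {K : pzRingType} {U : lmodType K} {A : palgType K} {f : U -> A}.
Hypothesis flin : scal_linear f.

Lemma scal_linearD x y : f (x + y) = f x + f y.
Proof. by rewrite -[x in LHS]scale1r flin rmorph1 mul1r. Qed.
Lemma scal_linear0 : f 0 = 0.
Proof. by apply: (addrI (f 0)); rewrite -scal_linearD !addr0. Qed.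
Lemma scal_linearZ a x : f (a *: x) = scal a * f x.
Proof. by rewrite -[a *: x]addr0 flin scal_linear0 addr0. Qed.
Lemma scal_linearN x : f (- x) = - f x.
Proof. by apply/eqP; rewrite -addr_eq0 -scal_linearD addNr scal_linear0. Qed.
Lemma scal_linearB x y : f (x - y) = f x - f y.
Proof. by rewrite scal_linearD scal_linearN. Qed.
Lemma scal_linear_sum I (r : seq I) (F : I -> U) :
  f (\sum_(i <- r) F i) = \sum_(i <- r) f (F i).
Proof. exact: (big_morph f scal_linearD scal_linear0). Qed.
End ScalLinear.

Lemma rmorph_scal_linear {K : pzRingType} {U : lmodType K} {A B : palgType K}
    {f : {rmorphism A -> B}} {g : U -> A} :
  (forall a : K, f (scal a) = scal a) -> scal_linear g ->
  scal_linear (fun u => f (g u)).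
Proof. by move=> fscal glin a x y; rewrite glin rmorphD rmorphM fscal. Qed.

Lemma quot_pi_linear {K : pzRingType} {U : lmodType K} {A : palgType K}
    (S : A -> Prop) (f : U -> A) :
  scal_linear f -> scal_linear (fun u => quot_pi S (f u)).
Proof. exact: rmorph_scal_linear. Qed.

(** * Enveloping algebras *)

Lemma env_in_linear {K : comNzRingType} (L : lieAlgType K) :
  scal_linear (@env_in K L).
Proof.
move=> a x y; rewrite /env_in.
have -> : scal a * quot_pi _ (gen x) + quot_pi _ (gen y)
    = quot_pi (@envelope_rel K L) (scal a * gen x + gen y).
  by rewrite rmorphD rmorphM.
exact/quot_rel/EnvLinear.
Qed.

Lemma env_in_bracket {K : comNzRingType} {L : lieAlgType K} (x y : L) :
  env_in (lie x y) = commutator (env_in x) (env_in y).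
Proof. exact/esym/quot_commutator/EnvBracket. Qed.

Lemma envelope_lift {K : comNzRingType} {L : lieAlgType K} {B : palgType K}
    (g : L -> B) :
  scal_linear g -> (forall x y, g (lie x y) = commutator (g x) (g y)) ->
  exists F : {rmorphism envelope L -> B},
    (forall a : K, F (scal a) = scal a) /\ forall x, F (env_in x) = g x.
Proof.
move=> glin glie; have [f [fscal fgen]] := @free_alg_lift K L B g.
have [_ [a x y|x y]|F FE] := quot_lift (S := @envelope_rel K L) f.
- by rewrite rmorphB rmorphD rmorphM fscal !fgen glin subrr.
- by rewrite rmorphB (rmorph_commutatorE (fgen x) (fgen y)) fgen glie subrr.
by exists F; split=> [a|x]; rewrite FE.
Qed.

Lemma envelope_ind {K : comNzRingType} {L : lieAlgType K}
    (P : envelope L -> Prop) :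
  subalgebra P -> (forall x, P (env_in x)) -> forall u, P u.
Proof.
move=> Psub Pgen; apply: (@quot_ind K (free_alg K L) _ P).
apply: free_alg_ind => //.
exact: (@subalgebra_preim _ (free_alg K L) _ (quot_pi (@envelope_rel K L))).
Qed.

(** * The Weyl algebra *)

Section WeylAlgebra.
Context {K : comNzRingType} {n : nat}.
Local Notation t := (@weyl_t K n).
Local Notation d := (@weyl_d K n).

Lemma weyl_tt i j : commutator (t i) (t j) = 0.
Proof. exact/quot_commutator0/WeylTT. Qed.
Lemma weyl_dd i j : commutator (d i) (d j) = 0.
Proof. exact/quot_commutator0/WeylDD. Qed.
Lemma weyl_dt i j : commutator (d i) (t j) = scal (i == j)%:R.
Proof. exact/quot_commutator/WeylDT. Qed.

Lemma weyl_lift {B : palgType K} (p q : 'I_n -> B) :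
  (forall i j, commutator (p i) (p j) = 0) ->
  (forall i j, commutator (q i) (q j) = 0) ->
  (forall i j, commutator (q i) (p j) = scal (i == j)%:R) ->
  exists F : {rmorphism weyl K n -> B},
    [/\ forall a : K, F (scal a) = scal a, forall i, F (t i) = p i &
        forall i, F (d i) = q i].
Proof.
move=> pp qq qp; have [f [fscal fgen]] := @free_alg_lift K _ B
  (fun s : 'I_n + 'I_n => match s with inl i => p i | inr i => q i end).
have [_ [i j|i j|i j]|F FE] := quot_lift (S := @weyl_rel K n) f.
- exact: etrans (rmorph_commutatorE (fgen (inl i)) (fgen (inl j))) (pp i j).
- exact: etrans (rmorph_commutatorE (fgen (inr i)) (fgen (inr j))) (qq i j).
- rewrite [LHS]rmorphB.
  rewrite (rmorph_commutatorE (fgen (inr i)) (fgen (inl j))).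
  by rewrite fscal qp subrr.
by exists F; split=> [a|i|i]; rewrite FE ?fscal ?fgen.
Qed.

Lemma weyl_ind (P : weyl K n -> Prop) :
  subalgebra P -> (forall i, P (t i)) -> (forall i, P (d i)) -> forall u, P u.
Proof.
move=> Psub Pt Pd; apply: (@quot_ind K (free_alg K _) _ P).
have Psub' := @subalgebra_preim _ (free_alg K _) _
  (quot_pi (@weyl_rel K n)) P (fun=> erefl) Psub.
by apply: (free_alg_ind _ Psub'); case=> i; [exact: Pt | exact: Pd].
Qed.
End WeylAlgebra.

(** * Tensor products *)

Section TensorProduct.
Context {K : comNzRingType} {A B : palgType K}.
Local Notation T := (tensor A B).

Lemma tensM (a a' : A) (b b' : B) : (a ⊗ b) * (a' ⊗ b') = (a * a') ⊗ (b * b').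
Proof. by rewrite -[LHS]rmorphM; congr (quot_pi _ _); exact: mmult_base. Qed.

Lemma tens1 : 1 ⊗ 1 = 1 :> T.
Proof. by rewrite /tens -(rmorph1 (quot_pi _)). Qed.

Lemma tensDl (a a' : A) (b : B) : (a + a') ⊗ b = a ⊗ b + a' ⊗ b.
Proof. by rewrite /tens -rmorphD; apply/quot_rel/BilinDl. Qed.
Lemma tensDr (a : A) (b b' : B) : a ⊗ (b + b') = a ⊗ b + a ⊗ b'.
Proof. by rewrite /tens -rmorphD; apply/quot_rel/BilinDr. Qed.
Lemma tensZl c (a : A) (b : B) : (scal c * a) ⊗ b = scal c * (a ⊗ b).
Proof. by rewrite /tens -quot_piZ; apply/quot_rel/BilinZl. Qed.
Lemma tensZr c (a : A) (b : B) : a ⊗ (scal c * b) = scal c * (a ⊗ b).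
Proof. by rewrite /tens -quot_piZ; apply/quot_rel/BilinZr. Qed.

Definition tens_left (a : A) : T := a ⊗ 1.
Definition tens_right (b : B) : T := 1 ⊗ b.

Fact tens_left_is_zmod_morphism : zmod_morphism tens_left.
Proof.
move=> a a'; rewrite -[- a']mulN1r -(rmorphN1 (@scal K A)).
by rewrite /tens_left tensDl tensZl rmorphN1 mulN1r.
Qed.
Fact tens_left_is_monoid_morphism : monoid_morphism tens_left.
Proof. by split=> [|a a']; rewrite /tens_left ?tens1 // tensM mulr1. Qed.
HB.instance Definition _ :=
  GRing.isZmodMorphism.Build A T tens_left tens_left_is_zmod_morphism.
HB.instance Definition _ :=
  GRing.isMonoidMorphism.Build A T tens_left tens_left_is_monoid_morphism.

Fact tens_right_is_zmod_morphism : zmod_morphism tens_right.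
Proof.
move=> a a'; rewrite -[- a']mulN1r -(rmorphN1 (@scal K B)).
by rewrite /tens_right tensDr tensZr rmorphN1 mulN1r.
Qed.
Fact tens_right_is_monoid_morphism : monoid_morphism tens_right.
Proof. by split=> [|a a']; rewrite /tens_right ?tens1 // tensM mulr1. Qed.
HB.instance Definition _ :=
  GRing.isZmodMorphism.Build B T tens_right tens_right_is_zmod_morphism.
HB.instance Definition _ :=
  GRing.isMonoidMorphism.Build B T tens_right tens_right_is_monoid_morphism.

Lemma tens_left_scal (c : K) : tens_left (scal c) = scal c.
Proof. by rewrite /tens_left -[scal c]mulr1 tensZl tens1 mulr1. Qed.
Lemma tens_right_scal (c : K) : tens_right (scal c) = scal c.
Proof. by rewrite /tens_right -[scal c]mulr1 tensZr tens1 mulr1. Qed.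

Lemma tens_split (a : A) (b : B) : a ⊗ b = tens_left a * tens_right b.
Proof. by rewrite tensM mulr1 mul1r. Qed.

Lemma tens_comm (a : A) (b : B) : GRing.comm (tens_left a) (tens_right b).
Proof. by rewrite /GRing.comm !tensM !mulr1 !mul1r. Qed.

Lemma tensor_lift {C : palgType K} (f : {rmorphism A -> C})
    (g : {rmorphism B -> C}) :
  (forall c : K, f (scal c) = scal c) -> (forall c : K, g (scal c) = scal c) ->
  (forall a b, GRing.comm (f a) (g b)) ->
  exists F : {rmorphism T -> C},
    [/\ forall c : K, F (scal c) = scal c, forall a, F (a ⊗ 1) = f a &
        forall b, F (1 ⊗ b) = g b].
Proof.
move=> fscal gscal fg.
have [||f0 [f0scal f0base]] := @monoid_alg_lift K (Defs.mul_pair A B) C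
  (fun p : (A * B)%type => f p.1 * g p.2).
- by rewrite !rmorph1 mulr1.
- move=> [a b] [a' b'] /=; rewrite !rmorphM -!mulrA; congr (_ * _).
  by rewrite !mulrA; congr (_ * _); exact: fg.
have [_ [a a' b|a b b'|c a b|c a b]|F FE] := quot_lift (S := @bilinear_rel K A B) f0.
- by rewrite rmorphB rmorphD !f0base /= rmorphD mulrDl subrr.
- by rewrite rmorphB rmorphD !f0base /= rmorphD mulrDr subrr.
- by rewrite rmorphB rmorphM !f0base f0scal /= rmorphM fscal mulrA subrr.
- rewrite rmorphB rmorphM !f0base f0scal /= rmorphM gscal.
  by rewrite !mulrA scalC subrr.
exists F; split=> [c|a|b]; rewrite FE ?f0scal // f0base /= rmorph1.
  by rewrite mulr1.
by rewrite mul1r.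
Qed.

Lemma tensor_ind (P : T -> Prop) :
  subalgebra P -> (forall a, P (a ⊗ 1)) -> (forall b, P (1 ⊗ b)) -> forall u, P u.
Proof.
case=> [Pscal PD PM] Pl Pr.
apply: (@quot_ind K (monoid_alg K (Defs.mul_pair A B)) _ P).
apply: (@monoid_alg_ind K (Defs.mul_pair A B)) => [x y Px Py|c [a b]].
  by rewrite rmorphD; apply: PD.
have -> : quot_pi _ (scal c * mbase ((a, b) : Defs.mul_pair A B))
    = scal c * (tens_left a * tens_right b) :> T.
  by rewrite -tens_split; exact: quot_piZ.
by apply: (PM); [exact: Pscal | apply: PM; [exact: Pl | exact: Pr]].
Qed.
End TensorProduct.

(** * The symplectic basis *)

Section SymplecticBasis.
Context {K : comNzRingType} {n : nat}.

(** The vectors [X_(eps_i)] and [X_(- eps_i)]. *)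
Definition basis_pos (i : 'I_n) : 'cV[K]_(n + n) := delta_mx (lshift n i) 0.
Definition basis_neg (i : 'I_n) : 'cV[K]_(n + n) := delta_mx (rshift n i) 0.

Lemma basis_decomp (v : 'cV[K]_(n + n)) :
  v = \sum_i (v (lshift n i) 0 *: basis_pos i + v (rshift n i) 0 *: basis_neg i).
Proof.
rewrite [LHS]matrix_sum_delta big_split_ord /= big_split /=.
by congr (_ + _); apply: eq_bigr => i _; rewrite big_ord1.
Qed.

Lemma heis_form_posl i (w : 'cV[K]_(n + n)) :
  heis_form (basis_pos i) w = w (rshift n i) 0.
Proof.
rewrite /heis_form (bigD1 i) //= big1 => [|k /negPf ki].
  by rewrite !mxE !eqxx eq_rlshift mul1r mul0r subr0 addr0.
by rewrite !mxE eq_lshift ki eq_rlshift !mul0r subr0.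
Qed.

Lemma heis_form_negl i (w : 'cV[K]_(n + n)) :
  heis_form (basis_neg i) w = - w (lshift n i) 0.
Proof.
rewrite /heis_form (bigD1 i) //= big1 => [|k /negPf ki].
  by rewrite !mxE !eqxx eq_lrshift mul1r mul0r sub0r addr0.
by rewrite !mxE eq_rshift ki eq_lrshift !mul0r subr0.
Qed.

Lemma heis_form_pospos i j : heis_form (basis_pos i) (basis_pos j) = 0.
Proof. by rewrite heis_form_posl mxE eq_rlshift. Qed.
Lemma heis_form_negneg i j : heis_form (basis_neg i) (basis_neg j) = 0.
Proof. by rewrite heis_form_negl mxE eq_lrshift oppr0. Qed.
Lemma heis_form_posneg i j : heis_form (basis_pos i) (basis_neg j) = (i == j)%:R.
Proof. by rewrite heis_form_posl mxE eq_rshift andbT. Qed.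
Lemma heis_form_negpos i j : heis_form (basis_neg i) (basis_pos j) = - (i == j)%:R.
Proof. by rewrite heis_form_negl mxE eq_lshift andbT. Qed.

Lemma scal_linear_basis {A : palgType K} {f : 'cV[K]_(n + n) -> A} v :
  scal_linear f ->
  f v = \sum_i (scal (v (lshift n i) 0) * f (basis_pos i)
              + scal (v (rshift n i) 0) * f (basis_neg i)).
Proof.
move=> flin; rewrite {1}[v]basis_decomp (scal_linear_sum flin).
by apply: eq_bigr => i _; rewrite (scal_linearD flin) !(scal_linearZ flin).
Qed.

Lemma scal_linear_basis_eq {A : palgType K} (f g : 'cV[K]_(n + n) -> A) :
  scal_linear f -> scal_linear g ->
  (forall i, f (basis_pos i) = g (basis_pos i)) ->
  (forall i, f (basis_neg i) = g (basis_neg i)) -> f =1 g.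
Proof.
move=> flin glin fgp fgq v.
rewrite (scal_linear_basis v flin) (scal_linear_basis v glin).
by apply: eq_bigr => i _; rewrite fgp fgq.
Qed.

Lemma sp_entries (X : sp K n) (i k : 'I_n) :
  [/\ sp_val X (rshift n k) (rshift n i) = - sp_val X (lshift n i) (lshift n k),
      sp_val X (lshift n k) (rshift n i) = sp_val X (lshift n i) (rshift n k) &
      sp_val X (rshift n k) (lshift n i) = sp_val X (rshift n i) (lshift n k)].
Proof.
case: X => X /= /and3P[/eqP/matrixP dr /eqP/matrixP ur /eqP/matrixP dl].
by move: (dr k i) (ur k i) (dl k i); rewrite !mxE.
Qed.

(** The bivector [sum_i e_(n+i) ∧ e_i] is the inverse of the form, so [sp_2n]
    kills it; a bilinear map evaluated on the image of this bivector therefore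
    vanishes.  In coordinates, exchanging the two summation indices matches the
    terms through the block relations of [sp_2n]. *)
Lemma symplectic_contraction_inv {A : palgType K}
    (b : 'cV[K]_(n + n) -> 'cV[K]_(n + n) -> A) (X : sp K n) :
  (forall w, scal_linear (b^~ w)) -> (forall v, scal_linear (b v)) ->
  \sum_i (b (sp_val X *m basis_neg i) (basis_pos i)
        - b (sp_val X *m basis_pos i) (basis_neg i))
  = \sum_i (b (basis_pos i) (sp_val X *m basis_neg i)
          - b (basis_neg i) (sp_val X *m basis_pos i)).
Proof.
move=> blinl blinr.
have XE k j : (sp_val X *m delta_mx j 0 : 'cV_(n + n)) k 0 = sp_val X k j.
  by rewrite -colE mxE.
under eq_bigr => i _ do rewrite (scal_linear_basis _ (blinl _))
  [in X in _ - X](scal_linear_basis _ (blinl _)) -sumrB.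
under [RHS]eq_bigr => i _ do rewrite (scal_linear_basis _ (blinr _))
  [in X in _ - X](scal_linear_basis _ (blinr _)) -sumrB.
rewrite [RHS]exchange_big /=; apply: eq_bigr => i _; apply: eq_bigr => k _.
rewrite !XE; have [-> -> ->] := sp_entries X i k.
have [-> _ _] := sp_entries X k i.
by rewrite !rmorphN !mulNr !opprD addrACA.
Qed.
End SymplecticBasis.

(** * Quadratic elements *)

Section Metaplectic.
Context {K : fieldType} {n : nat} {A : palgType K}.
Variable q : 'cV[K]_(n + n) -> A.

(** For [M] in [sp_2n], its image under [sp_2n = Sym^2(K^(2n))], realized as a
    quadratic expression in [q]: contraction with the inverse of the form turns the
    endomorphism [M] into a tensor of degree 2.  This is the representation of
    [sp_2n] by quadratic elements of the Weyl algebra. *)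
Definition metaplectic (M : 'M[K]_(n + n)) : A :=
  scal 2^-1 * \sum_i (q (M *m basis_neg i) * q (basis_pos i)
                    - q (M *m basis_pos i) * q (basis_neg i)).

Hypothesis qlin : scal_linear q.

Lemma metaplectic_linear : scal_linear metaplectic.
Proof.
move=> a M N; rewrite /metaplectic mulrA -rmorphM (mulrC a) rmorphM -mulrA -mulrDr.
congr (_ * _); rewrite mulr_sumr -big_split /=; apply: eq_bigr => i _.
rewrite !mulmxDl -!scalemxAl !qlin !mulrDl !mulrBr !mulrA.
by rewrite opprD addrACA.
Qed.

Hypothesis two_neq0 : (2 : K) != 0.
Hypothesis qform : forall v w, commutator (q v) (q w) = scal (heis_form v w).

Lemma half_double (x : A) : scal 2^-1 * (x + x) = x.
Proof.
rewrite -[x in x + x]mul1r -mulrDl -(rmorph1 (@scal K A)) -rmorphD mulrA -rmorphM.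
by rewrite mulVf // rmorph1 mul1r.
Qed.

(** By the Leibniz rule each product contributes two terms, one for each factor.
    Summed over [i] they give [q(X w)] twice: directly from the first kind, and
    from the second kind because [X] is skew for the form. *)
Lemma commutator_metaplectic_vec (X : sp K n) w :
  commutator (metaplectic (sp_val X)) (q w) = q (sp_val X *m w).
Proof.
rewrite /metaplectic commutatorZl commutator_suml -[RHS]half_double; congr (_ * _).
have qXlin : scal_linear (fun v => q (sp_val X *m v)).
  by move=> a u v; rewrite mulmxDr -scalemxAr qlin.
rewrite {1}(scal_linear_basis w qXlin) (scal_linear_basis (sp_val X *m w) qlin).
rewrite -big_split /=; apply: eq_bigr => i _.
rewrite commutatorBl !commutatorMl !qform heis_form_posl heis_form_negl.
rewrite !(heis_formC (sp_val X *m _)) !(heis_form_sp X w) heis_form_negl heis_form_posl.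
rewrite opprK !rmorphN !mulNr !mulrN !scalC.
by rewrite opprD !opprK addrACA [_ + q (sp_val X *m basis_pos i) * _]addrC.
Qed.

Lemma metaplecticB M N : metaplectic (M - N) = metaplectic M - metaplectic N.
Proof. exact: scal_linearB metaplectic_linear _ _. Qed.

(** Deriving [metaplectic Y] by [metaplectic X] gives terms
    [q(X Y u) q(v)] and [q(Y u) q(X v)].  The former make up
    [metaplectic (X Y)]; invariance of the bivector, applied to the bilinear map
    [(u, v) |-> q(Y u) q(v)], turns the latter into [- metaplectic (Y X)]. *)
Lemma commutator_metaplectic (X Y : sp K n) :
  commutator (metaplectic (sp_val X)) (metaplectic (sp_val Y))
  = metaplectic (sp_val (lie X Y)).
Proof.
rewrite /= metaplecticB {2 3 4}/metaplectic commutatorZr commutator_sumr -mulrBr.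
congr (_ * _); under [X in _ = X - _]eq_bigr => i _ do rewrite -!mulmxA.
under [X in _ = _ - X]eq_bigr => i _ do rewrite -!mulmxA.
rewrite (symplectic_contraction_inv (fun v w => q (sp_val Y *m v) * q w)).
- rewrite -sumrB; apply: eq_bigr => i _.
  rewrite commutatorBr !commutatorMr !commutator_metaplectic_vec.
  by rewrite !opprD opprK addrACA [in RHS](addrC (- _)).
- by move=> w a u v; rewrite mulmxDr -scalemxAr qlin mulrDl mulrA.
- by move=> v a u w; rewrite qlin mulrDr !mulrA -scalC.
Qed.

Lemma metaplectic_delta_pos (a : 'I_(n + n)) j :
  metaplectic (delta_mx a (lshift n j)) =
  - (scal 2^-1 * (q (delta_mx a 0) * q (basis_neg j))).
Proof.
rewrite /metaplectic -mulrN; congr (_ * _).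
rewrite (bigD1 j) //= big1 => [|k /negPf kj].
  rewrite mul_delta_mx mul_delta_mx_0 ?eq_lrshift // (scal_linear0 qlin).
  by rewrite mul0r sub0r addr0.
rewrite !mul_delta_mx_0 ?eq_lrshift ?eq_lshift 1?eq_sym ?kj //.
by rewrite (scal_linear0 qlin) !mul0r subr0.
Qed.

Lemma metaplectic_delta_neg (a : 'I_(n + n)) j :
  metaplectic (delta_mx a (rshift n j)) =
  scal 2^-1 * (q (delta_mx a 0) * q (basis_pos j)).
Proof.
rewrite /metaplectic; congr (_ * _).
rewrite (bigD1 j) //= big1 => [|k /negPf kj].
  rewrite mul_delta_mx mul_delta_mx_0 ?eq_rlshift // (scal_linear0 qlin).
  by rewrite mul0r subr0 addr0.
rewrite !mul_delta_mx_0 ?eq_rlshift ?eq_rshift 1?eq_sym ?kj //.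
by rewrite (scal_linear0 qlin) !mul0r subr0.
Qed.

Lemma commutator_swap v w : q v * q w = q w * q v + scal (heis_form v w).
Proof. by rewrite -qform addrC subrK. Qed.

(** The symmetric ordering [(q u * q v + q v * q u) / 2] differs from
    [q u * q v] by half the form, which gives the constant at [i = j]. *)
Lemma metaplectic_pm i j :
  metaplectic (sp_val (root_pm K i j))
  = - (q (basis_pos i) * q (basis_neg j)) + scal (2^-1 * (i == j)%:R).
Proof.
rewrite metaplecticB !(metaplectic_delta_pos, metaplectic_delta_neg).
rewrite [q (delta_mx _ _) * q (basis_pos i)]commutator_swap heis_form_negpos eq_sym.
rewrite mulrDr opprD addrA -opprD -mulrDr half_double -rmorphM mulrN rmorphN opprK.
by [].
Qed.

Lemma metaplectic_h i :
  metaplectic (sp_val (root_h K i))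
  = - (q (basis_pos i) * q (basis_neg i)) + scal 2^-1.
Proof. by rewrite [LHS](metaplectic_pm i i) eqxx mulr1. Qed.

Lemma metaplectic_pp i j :
  metaplectic (sp_val (root_pp K i j)) = q (basis_pos i) * q (basis_pos j).
Proof.
rewrite (scal_linearD metaplectic_linear) !metaplectic_delta_neg.
rewrite [X in _ + _ * X]commutator_swap heis_form_pospos rmorph0 addr0.
by rewrite -mulrDr half_double.
Qed.

Lemma metaplectic_mm i j :
  metaplectic (sp_val (root_mm K i j)) = - (q (basis_neg i) * q (basis_neg j)).
Proof.
rewrite (scal_linearD metaplectic_linear) !metaplectic_delta_pos.
rewrite [X in _ - _ * X]commutator_swap heis_form_negneg rmorph0 addr0.
by rewrite -opprD -mulrDr half_double.
Qed.
End Metaplectic.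

Lemma eq_metaplectic {K : fieldType} {n : nat} {A : palgType K}
    {q q' : 'cV[K]_(n + n) -> A} : q =1 q' -> metaplectic q =1 metaplectic q'.
Proof.
move=> qq' M; rewrite /metaplectic; congr (_ * _).
by apply: eq_bigr => i _; rewrite !qq'.
Qed.

Lemma rmorph_metaplectic {K : fieldType} {n : nat} {A B : palgType K}
    (f : {rmorphism A -> B}) (q : 'cV[K]_(n + n) -> A)
    (q' : 'cV[K]_(n + n) -> B) M :
  (forall a : K, f (scal a) = scal a) -> (forall v, f (q v) = q' v) ->
  f (metaplectic q M) = metaplectic q' M.
Proof.
move=> fscal fq; rewrite /metaplectic rmorphM fscal rmorph_sum; congr (_ * _).
by apply: eq_bigr => i _; rewrite rmorphB !rmorphM !fq.
Qed.

Lemma commutator_metaplectic0 {K : fieldType} {n : nat} {A : palgType K}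
    (q : 'cV[K]_(n + n) -> A) (x : A) M :
  (forall v, commutator x (q v) = 0) -> commutator x (metaplectic q M) = 0.
Proof.
move=> xq; rewrite /metaplectic commutatorZr commutator_sumr big1 ?mulr0 // => i _.
by rewrite commutatorBr !commutatorMr !xq !mulr0 !mul0r addr0 subr0.
Qed.

(** Both sides are bilinear, so the values on basis vectors suffice. *)
Lemma commutator_heis_form {K : comNzRingType} {n : nat} {A : palgType K}
    (q : 'cV[K]_(n + n) -> A) :
  scal_linear q ->
  (forall i j, commutator (q (basis_pos i)) (q (basis_pos j)) = 0) ->
  (forall i j, commutator (q (basis_neg i)) (q (basis_neg j)) = 0) ->
  (forall i j, commutator (q (basis_pos i)) (q (basis_neg j)) = scal (i == j)%:R) ->
  forall v w, commutator (q v) (q w) = scal (heis_form v w).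
Proof.
move=> qlin qpp qqq qpq v w.
have lin1 y : scal_linear (fun v => commutator (q v) y).
  by move=> a u u'; rewrite qlin commutatorDl commutatorZl.
have lin2 x : scal_linear (fun w => commutator x (q w)).
  by move=> a u u'; rewrite qlin commutatorDr commutatorZr.
have form1 y : scal_linear (fun v : 'cV[K]_(n + n) => scal (heis_form v y) : A).
  by move=> a u u'; rewrite heis_form_linearl rmorphD rmorphM.
have form2 x : scal_linear (fun w : 'cV[K]_(n + n) => scal (heis_form x w) : A).
  by move=> a u u'; rewrite heis_form_linearr rmorphD rmorphM.
apply: (scal_linear_basis_eq _ _ (lin1 _) (form1 _)) => i.
  apply: (scal_linear_basis_eq _ _ (lin2 _) (form2 _)) => j.
    by rewrite qpp heis_form_pospos rmorph0.
  by rewrite qpq heis_form_posneg.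
apply: (scal_linear_basis_eq _ _ (lin2 _) (form2 _)) => j.
  by rewrite commutatorC qpq heis_form_negpos eq_sym rmorphN.
by rewrite qqq heis_form_negneg rmorph0.
Qed.

(** * The Weyl algebra as the algebra of the symplectic form *)

Section WeylVectors.
Context {K : comNzRingType} {n : nat}.

Section SymplecticVectors.
Context {A : palgType K}.
Variables p d : 'I_n -> A.

(** The sign makes the commutator of two such vectors the form itself when
    [[d i, p j] = (i == j)]. *)
Definition symp_vec (v : 'cV[K]_(n + n)) : A :=
  \sum_i (scal (v (lshift n i) 0) * p i - scal (v (rshift n i) 0) * d i).

Lemma symp_vec_linear : scal_linear symp_vec.
Proof.
move=> a u v; rewrite /symp_vec mulr_sumr -big_split /=; apply: eq_bigr => i _.
by rewrite !mxE !rmorphD !rmorphM !mulrDl mulrBr !mulrA opprD addrACA.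
Qed.

Lemma symp_vec_pos i : symp_vec (basis_pos i) = p i.
Proof.
rewrite /symp_vec (bigD1 i) //= big1 => [|k /negPf ki].
  by rewrite !mxE !eqxx eq_rlshift rmorph1 rmorph0 mul1r mul0r subr0 addr0.
by rewrite !mxE eq_lshift ki eq_rlshift rmorph0 !mul0r subr0.
Qed.

Lemma symp_vec_neg i : symp_vec (basis_neg i) = - d i.
Proof.
rewrite /symp_vec (bigD1 i) //= big1 => [|k /negPf ki].
  by rewrite !mxE !eqxx eq_lrshift rmorph1 rmorph0 mul1r mul0r sub0r addr0.
by rewrite !mxE eq_rshift ki eq_lrshift rmorph0 !mul0r subr0.
Qed.
End SymplecticVectors.

Definition weyl_vec : 'cV[K]_(n + n) -> weyl K n :=
  symp_vec (@weyl_t K n) (@weyl_d K n).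

Lemma weyl_vec_linear : scal_linear weyl_vec.
Proof. exact: symp_vec_linear. Qed.
Lemma weyl_vec_pos i : weyl_vec (basis_pos i) = weyl_t K i.
Proof. exact: symp_vec_pos. Qed.
Lemma weyl_vec_neg i : weyl_vec (basis_neg i) = - weyl_d K i.
Proof. exact: symp_vec_neg. Qed.

Lemma weyl_vec_form v w :
  commutator (weyl_vec v) (weyl_vec w) = scal (heis_form v w).
Proof.
apply: commutator_heis_form v w => [|i j|i j|i j]; first exact: weyl_vec_linear.
- by rewrite !weyl_vec_pos; exact: weyl_tt.
- by rewrite !weyl_vec_neg commutatorNl commutatorNr opprK; exact: weyl_dd.
- by rewrite weyl_vec_pos weyl_vec_neg commutatorNr -commutatorC eq_sym; exact: weyl_dt.
Qed.

Lemma weyl_vec_lift {B : palgType K} (q : 'cV[K]_(n + n) -> B) :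
  scal_linear q ->
  (forall v w, commutator (q v) (q w) = scal (heis_form v w)) ->
  exists F : {rmorphism weyl K n -> B},
    (forall a : K, F (scal a) = scal a) /\ forall v, F (weyl_vec v) = q v.
Proof.
move=> qlin qform.
have [i j|i j|i j|F [Fscal Ft Fd]] :=
  weyl_lift (fun i => q (basis_pos i)) (fun i => - q (basis_neg i)).
- by rewrite [LHS]qform heis_form_pospos rmorph0.
- rewrite commutatorNl commutatorNr opprK qform.
  by rewrite heis_form_negneg rmorph0.
- rewrite commutatorNl qform heis_form_negpos.
  by rewrite rmorphN opprK.
exists F; split=> //.
apply: scal_linear_basis_eq => // [a u v|i|i].
- by rewrite weyl_vec_linear rmorphD rmorphM Fscal.
- by rewrite weyl_vec_pos Ft.
- by rewrite weyl_vec_neg rmorphN Fd opprK.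
Qed.

Lemma weyl_vec_ind (P : weyl K n -> Prop) :
  subalgebra P -> (forall v, P (weyl_vec v)) -> forall u, P u.
Proof.
move=> Psub Pv; apply: weyl_ind => // i; first by rewrite -weyl_vec_pos.
case: Psub => Pscal _ PM.
have -> : weyl_d K i = scal (-1) * weyl_vec (basis_neg i).
  by rewrite weyl_vec_neg rmorphN1 mulN1r opprK.
exact: PM (Pscal _) (Pv _).
Qed.
End WeylVectors.

(** * The tensor product of an enveloping algebra and a Weyl algebra *)

Section TensorEnvelopeWeyl.
Context {K : comNzRingType} {L : lieAlgType K} {n : nat}.
Local Notation T := (tensor (envelope L) (weyl K n)).

(** The images of the two factors commute because the centralizer of an element
    is a subalgebra, so that commutation on generators is enough. *)
Lemma tensor_envelope_weyl_lift {B : palgType K} (rho : L -> B)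
    (q : 'cV[K]_(n + n) -> B) :
  scal_linear rho ->
  (forall x y, rho (lie x y) = commutator (rho x) (rho y)) ->
  scal_linear q ->
  (forall v w, commutator (q v) (q w) = scal (heis_form v w)) ->
  (forall x v, commutator (rho x) (q v) = 0) ->
  exists F : {rmorphism T -> B},
    [/\ forall a : K, F (scal a) = scal a, forall x, F (env_in x ⊗ 1) = rho x &
        forall v, F (1 ⊗ weyl_vec v) = q v].
Proof.
move=> rholin rholie qlin qform rhoq.
have [f [fscal fE]] := envelope_lift rho rholin rholie.
have [g [gscal gE]] := weyl_vec_lift q qlin qform.
have [//|//||F [Fscal Fl Fr]] := tensor_lift f g.
  move=> a b.
  apply: (envelope_ind _ (subalgebra_preim f _ fscal (subalgebra_comm (g b)))) => x.
  rewrite fE; apply/commr_sym.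
  apply: (weyl_vec_ind _ (subalgebra_preim g _ gscal (subalgebra_comm (rho x)))) => v.
  by rewrite gE; exact/commr_sym/commute_commutator0.
by exists F; split=> [a|x|v]; [exact: Fscal | rewrite Fl fE | rewrite Fr gE].
Qed.

Lemma tensor_envelope_weyl_ind (P : T -> Prop) :
  subalgebra P -> (forall x, P (env_in x ⊗ 1)) ->
  (forall v, P (1 ⊗ weyl_vec v)) -> forall u, P u.
Proof.
move=> Psub Pl Pr.
have subl : subalgebra (fun a : envelope L => P (a ⊗ 1)).
  exact: (subalgebra_preim tens_left P tens_left_scal Psub).
have subr : subalgebra (fun b : weyl K n => P (1 ⊗ b)).
  exact: (subalgebra_preim tens_right P tens_right_scal Psub).
apply: (tensor_ind P Psub); first exact: (envelope_ind _ subl Pl).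
exact: (weyl_vec_ind _ subr Pr).
Qed.
End TensorEnvelopeWeyl.

(** * The central quotient of the oscillator algebra *)

Section CentralQuotient.
Context {K : comNzRingType} {n : nat} {zdot : K}.
Local Notation E := (env_osc_quot n zdot).

Lemma osc_class_linear : scal_linear (@osc_class K n zdot).
Proof.
exact: quot_pi_linear (@env_in_linear K (osc K n)).
Qed.

Lemma osc_class_lie x y :
  @osc_class K n zdot (lie x y) = commutator (osc_class zdot x) (osc_class zdot y).
Proof. by rewrite /osc_class env_in_bracket; exact: rmorph_commutator. Qed.

Lemma osc_class_z : osc_class zdot (osc_z K n) = scal zdot.
Proof. exact: quot_rel. Qed.

Lemma env_osc_quot_lift {B : palgType K} (g : osc K n -> B) :
  scal_linear g ->
  (forall x y, g (lie x y) = commutator (g x) (g y)) ->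
  g (osc_z K n) = scal zdot ->
  exists F : {rmorphism E -> B},
    (forall a : K, F (scal a) = scal a) /\ forall x, F (osc_class zdot x) = g x.
Proof.
move=> glin glie gz; have [f [fscal fE]] := envelope_lift g glin glie.
have [_ ->|F FE] := quot_lift (S := @central_rel K n zdot) f.
  by rewrite rmorphB fE fscal gz subrr.
by exists F; split=> [a|x]; rewrite FE.
Qed.

Lemma env_osc_quot_ind (P : E -> Prop) :
  subalgebra P -> (forall x, P (osc_class zdot x)) -> forall u, P u.
Proof.
move=> Psub Pgen; apply: (@quot_ind K (envelope (osc K n)) _ P).
apply: envelope_ind => //.
exact: (@subalgebra_preim _ (envelope _) _ (quot_pi (@central_rel K n zdot))).
Qed.
End CentralQuotient.

(** * Representations of the oscillator algebra as commuting pairs *)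

Section OscillatorPairs.
Context {K : fieldType} {n : nat} {A : palgType K}.
Hypothesis two_neq0 : (2 : K) != 0.
Variable s : K.

Section OscRep.
Variables (rho : sp K n -> A) (q : 'cV[K]_(n + n) -> A).

(** From a commuting pair to a representation of the oscillator algebra: since
    [rho] and the quadratic part commute, [sp_2n] acts through their sum, and it
    acts on the vectors through the quadratic part alone. *)
Definition osc_rep (x : osc K n) : A :=
  rho x.1 + metaplectic q (sp_val x.1) + (scal s * q x.2.1 + scal (s ^+ 2 * x.2.2)).

Hypothesis rholin : scal_linear rho.
Hypothesis rholie : forall X Y, rho (lie X Y) = commutator (rho X) (rho Y).
Hypothesis qlin : scal_linear q.
Hypothesis qform : forall v w, commutator (q v) (q w) = scal (heis_form v w).
Hypothesis rhoq : forall X v, commutator (rho X) (q v) = 0.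

Lemma osc_rep_linear : scal_linear osc_rep.
Proof.
move=> a x y; rewrite /osc_rep /= rholin (metaplectic_linear _ qlin) qlin.
have -> : scal s * (scal a * q x.2.1 + q y.2.1)
    = scal a * (scal s * q x.2.1) + scal s * q y.2.1.
  by rewrite mulrDr !mulrA (scalC s).
have -> : s ^+ 2 * (a *: x.2 + y.2).2 = a * (s ^+ 2 * x.2.2) + s ^+ 2 * y.2.2.
  by rewrite /= mulrDr; congr (_ + _); exact: mulrCA.
rewrite rmorphD rmorphM !(mulrDr (scal a)) (addrACA (scal a * rho _)).
by rewrite (addrACA (scal a * (scal s * _))) (addrACA (scal a * rho _ + _)).
Qed.

Lemma osc_rep_lie x y :
  osc_rep (lie x y) = commutator (osc_rep x) (osc_rep y).
Proof.
rewrite [lie x y]osc_lieE /osc_rep /=.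
have rhomp X M : commutator (rho X) (metaplectic q M) = 0.
  exact: commutator_metaplectic0.
rewrite !(commutatorDl, commutatorDr) !(commutatorZl s, commutatorZr s).
rewrite !(commutator_scall, commutator_scalr) !addr0.
rewrite !rhomp !rhoq [commutator (metaplectic _ _) (rho _)]commutatorC rhomp.
rewrite [commutator (q _) (rho _)]commutatorC rhoq.
rewrite [commutator (q _) (metaplectic _ _)]commutatorC.
rewrite !(commutator_metaplectic_vec q qlin two_neq0 qform).
rewrite (commutator_metaplectic q qlin two_neq0 qform) qform -rholie.
rewrite (scal_linearB qlin) !(oppr0, mulr0, addr0, add0r).
by rewrite mulrBr mulrN expr2 !rmorphM -!mulrA !addrA.
Qed.

Lemma osc_rep_z : osc_rep (osc_z K n) = scal (s ^+ 2).
Proof.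
rewrite /osc_rep /= (scal_linear0 rholin) (scal_linear0 (metaplectic_linear _ qlin)).
by rewrite (scal_linear0 qlin) mulr0 !add0r mulr1.
Qed.

Lemma osc_rep_sp X : osc_rep (osc_sp X) = rho X + metaplectic q (sp_val X).
Proof. by rewrite /osc_rep /= (scal_linear0 qlin) !mulr0 rmorph0 !addr0. Qed.

Lemma osc_rep_v v : osc_rep (osc_v v) = scal s * q v.
Proof.
rewrite /osc_rep /= (scal_linear0 rholin).
rewrite (scal_linear0 (metaplectic_linear _ qlin)) mulr0 rmorph0.
by rewrite !(addr0, add0r).
Qed.
End OscRep.

Hypothesis s_neq0 : s != 0.

Section OscParts.
Variable c : osc K n -> A.

(** From a representation back to a commuting pair.  Dividing by [s] turns the
    bracket [zdot * form] into the form; subtracting the quadratic part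
    removes from [c X] its action on the vectors. *)
Definition heis_part (v : 'cV[K]_(n + n)) : A := scal s^-1 * c (osc_v v).
Definition sp_part (X : sp K n) : A :=
  c (osc_sp X) - metaplectic heis_part (sp_val X).

Hypothesis clin : scal_linear c.
Hypothesis clie : forall x y, c (lie x y) = commutator (c x) (c y).
Hypothesis cz : c (osc_z K n) = scal (s ^+ 2).

Lemma heis_part_linear : scal_linear heis_part.
Proof.
move=> a u v; rewrite /heis_part.
have -> : osc_v (a *: u + v) = a *: osc_v u + osc_v v.
  by rewrite /osc_v; congr (_, (_, _)); rewrite /= scaler0 addr0.
by rewrite clin mulrDr !mulrA [scal s^-1 * _]scalC.
Qed.

Lemma sp_part_linear : scal_linear sp_part.
Proof.
move=> a X Y; rewrite /sp_part (metaplectic_linear _ heis_part_linear).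
have -> : osc_sp (a *: X + Y) = a *: osc_sp X + osc_sp Y.
  by congr (_, _); rewrite /= scaler0 addr0.
by rewrite clin mulrBr opprD addrACA.
Qed.

Lemma heis_part_form v w :
  commutator (heis_part v) (heis_part w) = scal (heis_form v w).
Proof.
rewrite /heis_part commutatorZl commutatorZr -clie.
have -> : lie (osc_v v) (osc_v w) = heis_form v w *: osc_z K n.
  rewrite [LHS]osc_lieE; congr (_, (_, _)); rewrite /= ?scaler0 //.
  - by rewrite lie_alt.
  - by rewrite !mul0mx subrr.
  - by rewrite /GRing.scale /= mulr1.
rewrite (scal_linearZ clin) cz -!rmorphM.
by congr scal; field.
Qed.

Lemma commutator_osc_sp_heis X v :
  commutator (c (osc_sp X)) (heis_part v) = heis_part (sp_val X *m v).
Proof.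
rewrite /heis_part commutatorZr -clie; congr (_ * c _).
rewrite [LHS]osc_lieE; congr (_, (_, _)); rewrite /=.
- by apply: val_inj; rewrite /= mulmx0 mul0mx subrr.
- by rewrite mul0mx subr0.
- by rewrite heis_form0l.
Qed.

Lemma sp_part_heis X v : commutator (sp_part X) (heis_part v) = 0.
Proof.
rewrite commutatorBl commutator_osc_sp_heis.
rewrite (commutator_metaplectic_vec _ heis_part_linear two_neq0 heis_part_form).
by rewrite subrr.
Qed.

(** [sp_part X] commutes with every quadratic element, so in
    [c X = sp_part X + metaplectic X] the two summands contribute separately to
    [[c X, c Y]], and the quadratic contribution is already known. *)
Lemma sp_part_lie X Y :
  sp_part (lie X Y) = commutator (sp_part X) (sp_part Y).
Proof.
have comm0 Z M : commutator (sp_part Z) (metaplectic heis_part M) = 0.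
  by apply: commutator_metaplectic0 => v; exact: sp_part_heis.
have cE Z : c (osc_sp Z) = sp_part Z + metaplectic heis_part (sp_val Z).
  by rewrite subrK.
have -> : sp_part (lie X Y) = commutator (c (osc_sp X)) (c (osc_sp Y))
    - commutator (metaplectic heis_part (sp_val X))
                 (metaplectic heis_part (sp_val Y)).
  rewrite (commutator_metaplectic _ heis_part_linear two_neq0 heis_part_form).
  rewrite -clie /sp_part; congr (c _ - _).
  rewrite [RHS]osc_lieE; congr (_, (_, _)) => /=.
    by rewrite !mulmx0 subrr.
  by rewrite heis_form0l.
rewrite !cE (commutatorDl (sp_part X)) !(commutatorDr _ (sp_part Y)) !comm0 addr0.
rewrite [commutator (metaplectic _ _) (sp_part _)]commutatorC comm0 oppr0.
by rewrite add0r addrK.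
Qed.

Lemma osc_rep_parts x : osc_rep sp_part heis_part x = c x.
Proof.
case: x => X [v a]; rewrite /osc_rep /= subrK /heis_part mulrA -rmorphM mulfV //.
have -> : scal (s ^+ 2 * a) = scal a * c (osc_z K n) by rewrite cz -rmorphM mulrC.
rewrite rmorph1 mul1r -(scal_linearZ clin) -!(scal_linearD clin).
congr c; congr (_, (_, _)); rewrite /= ?scaler0 ?addr0 ?add0r //.
by rewrite /GRing.scale /= mulr1.
Qed.
End OscParts.

Lemma heis_part_osc_rep rho q : scal_linear rho -> scal_linear q ->
  heis_part (osc_rep rho q) =1 q.
Proof.
move=> rholin qlin v; rewrite /heis_part osc_rep_v //.
by rewrite mulrA -rmorphM mulVf // rmorph1 mul1r.
Qed.

Lemma sp_part_osc_rep rho q : scal_linear rho -> scal_linear q ->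
  sp_part (osc_rep rho q) =1 rho.
Proof.
move=> rholin qlin X; rewrite /sp_part osc_rep_sp //.
by rewrite (eq_metaplectic (heis_part_osc_rep _ _ rholin qlin)) addrK.
Qed.
End OscillatorPairs.

Lemma rmorph_osc_rep {K : fieldType} {n : nat} {A B : palgType K} (s : K)
    (f : {rmorphism A -> B}) rho rho' q q' (x : osc K n) :
  (forall a : K, f (scal a) = scal a) ->
  (forall X, f (rho X) = rho' X) -> (forall v, f (q v) = q' v) ->
  f (osc_rep s rho q x) = osc_rep s rho' q' x.
Proof.
move=> fscal frho fq; rewrite /osc_rep !rmorphD frho rmorphM !fscal fq.
by rewrite (rmorph_metaplectic f q q').
Qed.

Lemma rmorph_heis_part {K : fieldType} {n : nat} {A B : palgType K} (s : K)
    (f : {rmorphism A -> B}) (c : osc K n -> A) (c' : osc K n -> B) v :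
  (forall a : K, f (scal a) = scal a) -> (forall x, f (c x) = c' x) ->
  f (heis_part s c v) = heis_part s c' v.
Proof. by move=> fscal fc; rewrite /heis_part rmorphM fscal fc. Qed.

Lemma rmorph_sp_part {K : fieldType} {n : nat} {A B : palgType K} (s : K)
    (f : {rmorphism A -> B}) (c : osc K n -> A) (c' : osc K n -> B) X :
  (forall a : K, f (scal a) = scal a) -> (forall x, f (c x) = c' x) ->
  f (sp_part s c X) = sp_part s c' X.
Proof.
move=> fscal fc; rewrite /sp_part rmorphB fc; congr (_ - _).
by apply: rmorph_metaplectic => // v; exact: rmorph_heis_part.
Qed.

(** [c] and the pair [(rho, q)] generate [E] and [T], and the passage between
    representations and commuting pairs is bijective and natural; hence [phi]
    and [psi] are inverse on generators, and so everywhere. *)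
Lemma osc_rep_bijective {K : fieldType} {n : nat} {s : K} {E T : palgType K}
    {c : osc K n -> E} {rho : sp K n -> T} {q : 'cV[K]_(n + n) -> T}
    {phi : {rmorphism E -> T}} {psi : {rmorphism T -> E}} :
  s != 0 ->
  scal_linear c -> c (osc_z K n) = scal (s ^+ 2) ->
  scal_linear rho -> scal_linear q ->
  (forall P : E -> Prop, subalgebra P -> (forall x, P (c x)) -> forall u, P u) ->
  (forall P : T -> Prop, subalgebra P -> (forall X, P (rho X)) ->
     (forall v, P (q v)) -> forall u, P u) ->
  (forall a : K, phi (scal a) = scal a) -> (forall a : K, psi (scal a) = scal a) ->
  (forall x, phi (c x) = osc_rep s rho q x) ->
  (forall X, psi (rho X) = sp_part s c X) ->
  (forall v, psi (q v) = heis_part s c v) ->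
  bijective phi.
Proof.
move=> s_neq0 clin cz rholin qlin Eind Tind phiscal psiscal phiE psisp psivec.
exists psi.
- apply: (Eind _ (subalgebra_cancel phi psi phiscal psiscal)) => x.
  rewrite phiE (rmorph_osc_rep s psi _ _ _ _ _ psiscal psisp psivec).
  exact: osc_rep_parts.
- apply: (Tind _ (subalgebra_cancel psi phi psiscal phiscal)) => [X|v].
    rewrite psisp (rmorph_sp_part s phi _ _ _ phiscal phiE).
    exact: sp_part_osc_rep.
  rewrite psivec (rmorph_heis_part s phi _ _ _ phiscal phiE).
  exact: heis_part_osc_rep.
Qed.

(** * The isomorphism *)

Section Isomorphism.
Context {K : fieldType} {n : nat} {s : K}.
Hypotheses (two_neq0 : (2 : K) != 0) (s_neq0 : s != 0).

Local Notation E := (env_osc_quot n (s ^+ 2)).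
Local Notation T := (tensor (envelope (sp K n)) (weyl K n)).

(** The universal commuting pair. *)
Definition tens_sp (X : sp K n) : T := tens_left (env_in X).
Definition tens_vec (v : 'cV[K]_(n + n)) : T := tens_right (weyl_vec v).

Lemma tens_sp_linear : scal_linear tens_sp.
Proof. exact: rmorph_scal_linear tens_left_scal (env_in_linear _). Qed.
Lemma tens_vec_linear : scal_linear tens_vec.
Proof. exact: rmorph_scal_linear tens_right_scal weyl_vec_linear. Qed.
Lemma tens_sp_lie X Y :
  tens_sp (lie X Y) = commutator (tens_sp X) (tens_sp Y).
Proof. by rewrite /tens_sp env_in_bracket; exact: rmorph_commutator. Qed.
Lemma tens_vec_form v w :
  commutator (tens_vec v) (tens_vec w) = scal (heis_form v w).
Proof.
rewrite -(tens_right_scal (A := envelope (sp K n))) -weyl_vec_form.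
exact/esym/rmorph_commutator.
Qed.
Lemma tens_sp_vec X v : commutator (tens_sp X) (tens_vec v) = 0.
Proof. exact/commute_commutator0/tens_comm. Qed.

Lemma oscillator_isomorphism :
  exists phi : {rmorphism E -> T},
    [/\ bijective phi, forall a : K, phi (scal a) = scal a &
        forall x, phi (osc_class (s ^+ 2) x) = osc_rep s tens_sp tens_vec x].
Proof.
have [phi [phiscal phiE]] := env_osc_quot_lift _
  (osc_rep_linear s _ _ tens_sp_linear tens_vec_linear)
  (osc_rep_lie two_neq0 s _ _ tens_sp_lie tens_vec_linear tens_vec_form tens_sp_vec)
  (osc_rep_z s _ _ tens_sp_linear tens_vec_linear).
pose c := @osc_class K n (s ^+ 2).
have clin : scal_linear c := osc_class_linear.
have clie x y : c (lie x y) = commutator (c x) (c y) := osc_class_lie x y.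
have cz : c (osc_z K n) = scal (s ^+ 2) := osc_class_z.
have [psi [psiscal psisp psivec]] := tensor_envelope_weyl_lift _ _
  (sp_part_linear s c clin)
  (sp_part_lie two_neq0 s s_neq0 c clin clie cz)
  (heis_part_linear s c clin)
  (heis_part_form s s_neq0 c clin clie cz)
  (sp_part_heis two_neq0 s s_neq0 c clin clie cz).
exists phi; split; [|exact: phiscal|exact: phiE].
exact: (osc_rep_bijective s_neq0 clin cz tens_sp_linear tens_vec_linear
  env_osc_quot_ind tensor_envelope_weyl_ind phiscal psiscal phiE psisp psivec).
Qed.

Lemma tens_vec_pos i : tens_vec (basis_pos i) = 1 ⊗ weyl_t K i.
Proof. by rewrite /tens_vec weyl_vec_pos. Qed.
Lemma tens_vec_neg i : tens_vec (basis_neg i) = - (1 ⊗ weyl_d K i).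
Proof. by rewrite /tens_vec weyl_vec_neg; exact: (rmorphN tens_right). Qed.
Lemma tens_rightM (u u' : weyl K n) :
  (1 ⊗ u) * (1 ⊗ u') = 1 ⊗ (u * u') :> T.
Proof. by rewrite tensM mulr1. Qed.

Local Notation rep := (osc_rep s tens_sp tens_vec).

Lemma osc_rep_tens_sp X :
  rep (osc_sp X) = env_in X ⊗ 1 + metaplectic tens_vec (sp_val X).
Proof. exact: osc_rep_sp tens_vec_linear _. Qed.

Lemma osc_rep_tens_pm i j : i != j ->
  rep (osc_sp (root_pm K i j))
  = env_in (root_pm K i j) ⊗ 1 + 1 ⊗ (weyl_t K i * weyl_d K j).
Proof.
move=> /negPf ij; rewrite osc_rep_tens_sp; congr (_ + _).
rewrite (metaplectic_pm _ tens_vec_linear two_neq0 tens_vec_form) ij mulr0.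
by rewrite rmorph0 addr0 tens_vec_pos tens_vec_neg mulrN opprK tens_rightM.
Qed.

Lemma osc_rep_tens_h i :
  rep (osc_sp (root_h K i))
  = env_in (root_h K i) ⊗ 1 + 1 ⊗ (weyl_t K i * weyl_d K i) + scal 2^-1.
Proof.
rewrite osc_rep_tens_sp -addrA; congr (_ + _).
rewrite (metaplectic_h _ tens_vec_linear two_neq0 tens_vec_form).
by rewrite tens_vec_pos tens_vec_neg mulrN opprK tens_rightM.
Qed.

Lemma osc_rep_tens_pp i j :
  rep (osc_sp (root_pp K i j))
  = env_in (root_pp K i j) ⊗ 1 + 1 ⊗ (weyl_t K i * weyl_t K j).
Proof.
rewrite osc_rep_tens_sp; congr (_ + _).
rewrite (metaplectic_pp _ tens_vec_linear two_neq0 tens_vec_form).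
by rewrite !tens_vec_pos tens_rightM.
Qed.

Lemma osc_rep_tens_mm i j :
  rep (osc_sp (root_mm K i j))
  = env_in (root_mm K i j) ⊗ 1 - 1 ⊗ (weyl_d K i * weyl_d K j).
Proof.
rewrite osc_rep_tens_sp; congr (_ + _).
rewrite (metaplectic_mm _ tens_vec_linear two_neq0 tens_vec_form).
by rewrite !tens_vec_neg mulrNN tens_rightM.
Qed.

Lemma osc_rep_tens_p i : rep (root_p K i) = 1 ⊗ (scal s * weyl_t K i).
Proof.
by rewrite (osc_rep_v _ _ _ tens_sp_linear tens_vec_linear) tens_vec_pos tensZr.
Qed.

Lemma osc_rep_tens_m i : rep (root_m K i) = - (1 ⊗ (scal s * weyl_d K i)).
Proof.
rewrite (osc_rep_v _ _ _ tens_sp_linear tens_vec_linear) tens_vec_neg tensZr.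
exact: mulrN.
Qed.
End Isomorphism.

(** The scalars enter only through one half and the inverse of a square root of
    [zdot], so the isomorphism exists over every field that has them. *)
Theorem oscillator_isomorphism_roots {K : fieldType} {n : nat} {s : K} :
  (2 : K) != 0 -> s != 0 ->
  exists phi : {rmorphism env_osc_quot n (s ^+ 2)
                  -> tensor (envelope (sp K n)) (weyl K n)},
    [/\ bijective phi,
        forall a : K, phi (scal a) = scal a &
        forall i j : 'I_n,
        [/\ i != j ->
              phi (osc_class (s ^+ 2) (osc_sp (root_pm K i j)))
              = env_in (root_pm K i j) ⊗ 1 + 1 ⊗ (weyl_t K i * weyl_d K j),
            phi (osc_class (s ^+ 2) (osc_sp (root_pp K i j)))
            = env_in (root_pp K i j) ⊗ 1 + 1 ⊗ (weyl_t K i * weyl_t K j),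
            phi (osc_class (s ^+ 2) (osc_sp (root_mm K i j)))
            = env_in (root_mm K i j) ⊗ 1 - 1 ⊗ (weyl_d K i * weyl_d K j),
            phi (osc_class (s ^+ 2) (osc_sp (root_h K i)))
            = env_in (root_h K i) ⊗ 1 + 1 ⊗ (weyl_t K i * weyl_d K i)
              + scal 2^-1 &
            phi (osc_class (s ^+ 2) (root_p K i)) = 1 ⊗ (scal s * weyl_t K i)
            /\ phi (osc_class (s ^+ 2) (root_m K i))
               = - (1 ⊗ (scal s * weyl_d K i))]].
Proof.
move=> two_neq0 s_neq0.
have [phi [phibij phiscal phiE]] := oscillator_isomorphism (n := n) two_neq0 s_neq0.
exists phi; split; [exact: phibij | exact: phiscal |] => i j.
by split; [move=> ij | | | | split]; rewrite phiE;
  [exact: osc_rep_tens_pm | exact: osc_rep_tens_pp | exact: osc_rep_tens_mm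
  | exact: osc_rep_tens_h | exact: osc_rep_tens_p | exact: osc_rep_tens_m].
Qed.

Theorem proposition3 (R : realType) (n : nat) (hn : (1 <= n)%N)
    (zdot sqrtz : R[i]) (hz : zdot != 0) (hsqrt : sqrtz ^+ 2 = zdot) :
  exists phi : {rmorphism env_osc_quot n zdot
                  -> tensor (envelope (sp R[i] n)) (weyl R[i] n)},
    [/\ bijective phi,
        forall a : R[i], phi (scal a) = scal a &
        forall i j : 'I_n,
        [/\ i != j ->
              phi (osc_class zdot (osc_sp (root_pm R[i] i j)))
              = env_in (root_pm R[i] i j) ⊗ 1 + 1 ⊗ (weyl_t R[i] i * weyl_d R[i] j),
            phi (osc_class zdot (osc_sp (root_pp R[i] i j)))
            = env_in (root_pp R[i] i j) ⊗ 1 + 1 ⊗ (weyl_t R[i] i * weyl_t R[i] j),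
            phi (osc_class zdot (osc_sp (root_mm R[i] i j)))
            = env_in (root_mm R[i] i j) ⊗ 1 - 1 ⊗ (weyl_d R[i] i * weyl_d R[i] j),
            phi (osc_class zdot (osc_sp (root_h R[i] i)))
            = env_in (root_h R[i] i) ⊗ 1 + 1 ⊗ (weyl_t R[i] i * weyl_d R[i] i)
              + scal 2^-1 &
            phi (osc_class zdot (root_p R[i] i)) = 1 ⊗ (scal sqrtz * weyl_t R[i] i)
            /\ phi (osc_class zdot (root_m R[i] i))
               = - (1 ⊗ (scal sqrtz * weyl_d R[i] i))]].
Proof.
have two_neq0 : (2 : R[i]) != 0 by rewrite Num.Theory.pnatr_eq0.
have s_neq0 : sqrtz != 0 by apply: contraNneq hz => s0; rewrite -hsqrt s0 expr0n.
case: _ / hsqrt hz => _.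
exact: (@oscillator_isomorphism_roots R[i] n sqrtz two_neq0 s_neq0).
Qed.
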